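(* Let $\Omega\subset\mathbb{R}^n$ be a proper, open, nonempty subset, let $1<p\le q<\infty$ and $0<\beta<1$. Let $u$ and $v$ be two weights such that $\sigma=v^{-1/(p-1)}$ belongs to $A_\infty^\beta$. Then the centered local maximal operator $M_\beta^c$ is bounded from $L^p(v)$ to $L^q(u)$ if and only if $(u,v)\in \mathrm{A}_{p,q}^\beta$.
   Context: Cubes have sides parallel to the axes; $Q(x,l)$ is the cube with center $x$ and half side length $l>0$. $\mathrm{d}$ is the $d_\infty$ metric on $\mathbb{R}^n$, and $\mathrm{d}(x,\Omega^c)$ the corresponding distance to $\Omega^c=\mathbb{R}^n\setminus\Omega$. $\mathcal{F}_\beta=\{Q(x,l): x\in\Omega,\ l<\beta\,\mathrm{d}(x,\Omega^c)\}$. A weight is a nonnegative locally integrable function on $\Omega$; for a weight $w$ write $w(E)=\int_E w\,dx$, and $L^p(w)$ is the space of measurable $f$ on $\Omega$ with $\int_\Omega|f|^p w\,dx<\infty$. A weight $w$ belongs to $A_\infty^\beta$ if there are positive constants $c,\delta$ such that $\frac{w(E)}{w(Q)}\le c\left(\frac{|E|}{|Q|}\right)^\delta$ for every cube $Q\in\mathcal{F}_\beta$ and every measurable $E\subset Q$. For $1<p\le q<\infty$, $(u,v)\in\mathrm{A}_{p,q}^\beta$ means that there is a constant $C$ such that $\frac{u(Q)^{p/q}}{|Q|}\left(\frac{\sigma(Q)}{|Q|}\right)^{p-1}\le C$ for every cube $Q\in\mathcal{F}_\beta$, where $\sigma=v^{-1/(p-1)}$. For $x\in\Omega$ and a locally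 integrable $f$ on $\Omega$, $M_\beta^c f(x)=\sup\left\{\frac1{|Q|}\int_Q|f(y)|\,dy:\ Q=Q(x,l)\in\mathcal{F}_\beta\right\}$ (supremum over cubes in $\mathcal{F}_\beta$ centered at $x$). An operator $T$ is bounded from $L^p(v)$ to $L^q(u)$ if there is a constant $C$ with $\left(\int_\Omega |Tf|^q u\,dx\right)^{1/q}\le C\left(\int_\Omega|f|^p v\,dx\right)^{1/p}$ for all $f\in L^p(v)$. *)

(* Defs.v *)
From HB Require Import structures.
From mathcomp Require Import all_boot all_order all_algebra.
From mathcomp Require Import all_classical all_reals all_analysis.
From mathcomp Require Import measurable_realfun.

Set Implicit Arguments.
Unset Strict Implicit.
Unset Printing Implicit Defensive.
Import Order.TTheory GRing.Theory Num.Theory.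
Import numFieldNormedType.Exports.

Local Open Scope classical_set_scope.
Local Open Scope ring_scope.

(* R^n, n >= 1, is 'rV[R]_n.+1, whose norm in the library is the max norm, so
   that `|x - y| is the d_infinity distance. *)

Definition box (R : realType) (n : nat) (a b : 'rV[R]_n.+1) :
    set 'rV[R]_n.+1 :=
  [set x | forall i, a 0 i <= x 0 i <= b 0 i].

(* The truncation gives volume 0 to the pairs (a, b) for which the box is
   empty. *)
Definition box_vol (R : realType) (n : nat) (a b : 'rV[R]_n.+1) : R :=
  \prod_(i < n.+1) Num.max 0 (b 0 i - a 0 i).

Definition box_cover (R : realType) (n : nat) (A : set 'rV[R]_n.+1) :
    set (nat -> 'rV[R]_n.+1 * 'rV[R]_n.+1) :=
  [set B | A `<=` \bigcup_k box (B k).1 (B k).2].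

Definition lebesgue_outer (R : realType) (n : nat) (A : set 'rV[R]_n.+1) :
    \bar R :=
  ereal_inf
    [set (\sum_(k <oo) (box_vol (B k).1 (B k).2)%:E)%E | B in box_cover A].

Lemma box_vol_ge0 (R : realType) (n : nat) (a b : 'rV[R]_n.+1) :
  0 <= box_vol a b.
Proof. by apply: prodr_ge0 => i _; rewrite le_max lexx. Qed.

Lemma lebesgue_outer_ge0 (R : realType) (n : nat) (A : set 'rV[R]_n.+1) :
  (0 <= lebesgue_outer A)%E.
Proof.
apply: le_ereal_inf_tmp => _ [B _ <-].
by apply: nneseries_ge0 => k _ _; rewrite lee_fin box_vol_ge0.
Qed.

Lemma lebesgue_outer0 (R : realType) (n : nat) :
  @lebesgue_outer R n set0 = 0%E.
Proof.
apply/eqP; rewrite eq_le lebesgue_outer_ge0 andbT.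
apply: ereal_inf_lbound; exists (fun=> (0, 0)); first exact: sub0set.
apply: eseries0 => k _ _ /=; congr (_%:E).
by apply/eqP; rewrite prodf_seq_eq0; apply/hasP; exists ord0;
  rewrite ?mem_index_enum// !mxE subrr maxxx eqxx.
Qed.

Lemma le_lebesgue_outer (R : realType) (n : nat) :
  {homo @lebesgue_outer R n : A B / A `<=` B >-> (A <= B)%E}.
Proof.
move=> A B AB; apply: ereal_inf_le_tmp => _ [C BC <-].
by exists C => //; exact: subset_trans AB BC.
Qed.

Lemma lebesgue_outer_sigma_subadditive (R : realType) (n : nat) :
  sigma_subadditive (@lebesgue_outer R n).
Proof.
move=> A; have [[i ioo]|] := pselect (exists i, lebesgue_outer (A i) = +oo%E).
  rewrite (eseries_pinfty _ _ ioo) ?leey// => k _.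
  by rewrite -ltNye (lt_le_trans _ (lebesgue_outer_ge0 _)).
rewrite -forallNE => Aoo.
suff add2e (e : {posnum R}) : (lebesgue_outer (\bigcup_k A k) <=
    \sum_(i <oo) lebesgue_outer (A i) + e%:num%:E)%E.
  by apply/lee_addgt0Pr => _/posnumP[].
rewrite (le_trans _ (epsilon_trick _ _ _))//; last first.
  by move=> k; exact: lebesgue_outer_ge0.
pose vol (ab : 'rV[R]_n.+1 * 'rV[R]_n.+1) : \bar R := (box_vol ab.1 ab.2)%:E.
have vol_ge0 ab : (0 <= vol ab)%E by rewrite lee_fin box_vol_ge0.
pose P k (B : nat -> 'rV[R]_n.+1 * 'rV[R]_n.+1) := box_cover (A k) B /\
  (\sum_(j <oo) vol (B j) <=
     lebesgue_outer (A k) + (e%:num / (2 ^ k.+1)%:R)%:E)%E.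
have [G PG] : {G & forall k, P k (G k)}.
  apply: (@choice _ _ P) => k; rewrite /P /lebesgue_outer.
  set S := (X in ereal_inf X); move infS : (ereal_inf S) => iS.
  case: iS infS => [r Sr|Soo|Soo].
  - have en1 : 0 < e%:num / (2 ^ k.+1)%:R by [].
    have /(lb_ereal_inf_adherent en1) : ereal_inf S \is a fin_num by rewrite Sr.
    move=> [x [B AB volBx] xS].
    by exists B; split => //; rewrite /vol volBx -Sr; exact/ltW.
  - by have := Aoo k; rewrite /lebesgue_outer Soo.
  - by have := lebesgue_outer_ge0 (A k); rewrite /lebesgue_outer Soo.
have volG_ge0 x : (0 <= (vol \o uncurry G) x)%E by exact: vol_ge0.
apply: (@le_trans _ _ (\esum_(i in setT) (vol \o uncurry G) i)%E).
  apply: ereal_inf_lbound => /=.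
  have /card_esym/ppcard_eqP[f] := card_nat2.
  exists (uncurry G \o f).
    move=> t [i _ /(PG i).1[j _ Bijt]]; exists (f^-1%FUN (i, j)) => //=.
    by rewrite invK ?inE.
  rewrite -(esum_pred_image (vol \o uncurry G) _ xpredT) ?[fun=> _]set_true//.
  by rewrite image_eq.
rewrite (_ : esum _ _ = \sum_(i <oo) \sum_(j <oo) vol (G i j))%E; last first.
  pose J : nat -> set (nat * nat) := fun i => [set (i, j) | j in setT].
  rewrite (_ : setT = \bigcup_k J k); last first.
    by rewrite predeqE => -[a b]; split => // _; exists a => //; exists b.
  rewrite esum_bigcupT /=; last 2 first.
    - apply/trivIsetP => i j _ _ ij.
      rewrite predeqE => -[k m] /=; split => //= -[] [_] _ [<-{k} _].
      by move=> [m' _] [] /esym/eqP; rewrite (negbTE ij).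
    - by move=> /= [k m]; exact: vol_ge0.
  rewrite -(image_id [set: nat]) -fun_true esum_pred_image//; last first.
    by move=> k _; exact: esum_ge0.
  apply: eq_eseriesr => /= j _.
  rewrite -(esum_pred_image (vol \o uncurry G) (pair j) predT)//=; last first.
    by move=> ? ? _ _; exact: (@can_inj _ _ _ snd).
  by congr esum; rewrite predeqE => -[a b]; split; move=> [i _ <-]; exists i.
apply: lee_nneseries => [i _ _|i _]; first exact: nneseries_ge0.
exact: (PG i).2.
Qed.

HB.instance Definition _ (R : realType) (n : nat) :=
  isOuterMeasure.Build R 'rV[R]_n.+1 (@lebesgue_outer R n)
    (@lebesgue_outer0 R n) (@lebesgue_outer_ge0 R n)
    (@le_lebesgue_outer R n) (@lebesgue_outer_sigma_subadditive R n).

(* R^n with the sigma-algebra of all Lebesgue measurable sets, i.e. the sets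
   that are Caratheodory measurable for the Lebesgue outer measure. *)
Notation lebesgue_space R n := (caratheodory_type (@lebesgue_outer R n)).

Definition lebesgue (R : realType) (n : nat) :
    set (lebesgue_space R n) -> \bar R :=
  @lebesgue_outer R n.

HB.instance Definition _ (R : realType) (n : nat) :=
  isMeasure.Build _ (lebesgue_space R n) R (@lebesgue R n)
    (@caratheodory_measure0 _ _ (@lebesgue_outer R n))
    (@caratheodory_measure_ge0 _ _ (@lebesgue_outer R n))
    (@caratheodory_measure_sigma_additive _ _ (@lebesgue_outer R n)).

Definition cube (R : realType) (n : nat) (x : 'rV[R]_n.+1) (l : R) :
    set 'rV[R]_n.+1 :=
  closed_ball_ Num.norm x l.

Definition dist_to (R : realType) (n : nat) (x : 'rV[R]_n.+1)
    (A : set 'rV[R]_n.+1) : R :=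
  inf [set `|x - y| | y in A].

(* The half side lengths of the cubes of F_beta centered at x. *)
Definition local_radii (R : realType) (n : nat) (Omega : set 'rV[R]_n.+1)
    (beta : R) (x : 'rV[R]_n.+1) : set R :=
  [set l | 0 < l /\ l < beta * dist_to x (~` Omega)].

Definition local_cubes (R : realType) (n : nat) (Omega : set 'rV[R]_n.+1)
    (beta : R) : set (set 'rV[R]_n.+1) :=
  [set Q | exists x l,
    [/\ Omega x, local_radii Omega beta x l & Q = cube x l]].

Local Open Scope ereal_scope.

(* Weights take values in [0, +oo], so that v `^ (- 1 / (p - 1)) can be a weight
   also when v vanishes on a null set. *)
Definition is_weight (R : realType) (n : nat) (Omega : set 'rV[R]_n.+1)
    (w : 'rV[R]_n.+1 -> \bar R) : Prop :=
  [/\ measurable_fun (Omega : set (lebesgue_space R n))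
        (w : lebesgue_space R n -> \bar R),
      forall x, Omega x -> 0 <= w x &
      forall K : set 'rV[R]_n.+1, K `<=` Omega -> compact K ->
        \int[@lebesgue R n]_(x in K) w x < +oo].

Definition weight_mass (R : realType) (n : nat) (w : 'rV[R]_n.+1 -> \bar R)
    (E : set 'rV[R]_n.+1) : \bar R :=
  \int[@lebesgue R n]_(x in E) w x.

(* v to the power - 1 / (p - 1), with value +oo where v = 0 and 0 where
   v = +oo. The power is inverted afterwards because the library sets
   0 `^ r = 0 and +oo `^ r = +oo also for r < 0. *)
Definition dual_weight (R : realType) (n : nat) (p : R)
    (v : 'rV[R]_n.+1 -> \bar R) : 'rV[R]_n.+1 -> \bar R :=
  fun x => (v x `^ (p - 1)^-1%R)^-1.

(* In \bar R the quotient 0 / 0 is 0, so the inequality below holds trivially for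
   a cube Q of zero w-mass. *)
Definition A_infty (R : realType) (n : nat) (Omega : set 'rV[R]_n.+1)
    (beta : R) (w : 'rV[R]_n.+1 -> \bar R) : Prop :=
  is_weight Omega w /\
  exists c delta : R, [/\ (0 < c)%R, (0 < delta)%R &
    forall Q E : set 'rV[R]_n.+1, local_cubes Omega beta Q ->
      measurable (E : set (lebesgue_space R n)) -> E `<=` Q ->
      weight_mass w E / weight_mass w Q <=
        c%:E * (lebesgue E / lebesgue Q) `^ delta].

Definition A_pq (R : realType) (n : nat) (Omega : set 'rV[R]_n.+1)
    (beta p q : R) (u v : 'rV[R]_n.+1 -> \bar R) : Prop :=
  exists C : R, forall Q : set 'rV[R]_n.+1, local_cubes Omega beta Q ->
    weight_mass u Q `^ (p / q)%R / lebesgue Q *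
      (weight_mass (dual_weight p v) Q / lebesgue Q) `^ (p - 1)%R <= C%:E.

(* Meant for x in Omega; then all the cubes lie inside Omega. *)
Definition centered_local_maximal (R : realType) (n : nat)
    (Omega : set 'rV[R]_n.+1) (beta : R) (f : 'rV[R]_n.+1 -> R)
    (x : 'rV[R]_n.+1) : \bar R :=
  ereal_sup
    [set (lebesgue (cube x l))^-1 *
         \int[@lebesgue R n]_(y in cube x l) `|f y|%:E
    | l in local_radii Omega beta x].

Definition in_Lp (R : realType) (n : nat) (Omega : set 'rV[R]_n.+1) (p : R)
    (w : 'rV[R]_n.+1 -> \bar R) (f : 'rV[R]_n.+1 -> R) : Prop :=
  measurable_fun (Omega : set (lebesgue_space R n))
    (f : lebesgue_space R n -> R) /\
  \int[@lebesgue R n]_(x in Omega) ((`|f x| `^ p)%:E * w x) < +oo.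

Definition bounded_Lp_Lq (R : realType) (n : nat) (Omega : set 'rV[R]_n.+1)
    (p q : R) (v u : 'rV[R]_n.+1 -> \bar R)
    (T : ('rV[R]_n.+1 -> R) -> 'rV[R]_n.+1 -> \bar R) : Prop :=
  exists C : R, forall f : 'rV[R]_n.+1 -> R, in_Lp Omega p v f ->
    (\int[@lebesgue R n]_(x in Omega) (`|T f x| `^ q * u x)) `^ q^-1%R <=
    C%:E *
      (\int[@lebesgue R n]_(x in Omega) ((`|f x| `^ p)%:E * v x)) `^ p^-1%R.

(* Main.v *)
(* Sufficiency. The A_infty condition makes the sigma-mass of the sets
   {sigma > 2^k m} in a cube of sigma-mean m decay geometrically, which is a reverse
   Hoelder inequality for sigma. Hence Hoelder's inequality upgrades A_pq to
     u(Q)^(p/q) (mean_Q |h|)^r <= K int_Q |h|^r v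
   for some r < p, and Besicovitch's covering theorem for centered cubes turns this
   into a weak type bound with exponent r. As {M f > t} is contained in
   {M (f 1_{|f| > t/2}) > t/2}, summing the weak type bound over the levels
   t = e 2^k, with the help of l^1 in l^(q/p), gives the strong type bound on
   {M f > e} uniformly in e.
   Necessity. For y in Q(x,l) and small k, the cubes of half side 2kl centered in
   Q(y,kl) belong to F_beta and contain Q(y,kl); testing on sigma 1_{Q(y,kl)}
   yields A_pq on Q(y,kl). The A_infty condition gives sigma(Q(x,l)) <= D
   sigma(Q(y,kl)), and Q(x,l) is covered by boundedly many such cubes. *)
Require Import Defs.
From mathcomp Require Import all_boot all_order all_algebra.
From mathcomp Require Import all_classical all_reals all_analysis.
From mathcomp Require Import measurable_realfun ring lra.

Set Implicit Arguments.
Unset Strict Implicit.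
Unset Printing Implicit Defensive.
Import Order.TTheory GRing.Theory Num.Theory.
Import numFieldNormedType.Exports.
Local Open Scope classical_set_scope.
Local Open Scope ring_scope.

(** * Lebesgue measure of boxes and cubes *)

(** Locality shapes the necessity. Testing on a cube Q asks, at every point of Q, for a centered
    cube containing Q; twice the radius may violate l < beta d(x, Omega^c). Hence the passage to
    small cubes, where A_infty acts as a doubling condition for sigma. No doubling is known for u,
    so a pigeonhole argument finds one small cube carrying a fixed share of u(Q). The same lack of
    doubling shapes the sufficiency: a Vitali covering enlarges its cubes, which u does not
    tolerate, whereas Besicovitch's theorem keeps them and bounds their overlap. Its greedy choice
    needs a largest radius; this is secured by writing a level set as a countable union of cubes on
    each of which one radius serves all points, and by keeping finitely many of them. The gain r < p
    is what makes the sum over levels converge: at a point x it runs over the levels t < 2 |f(x)|,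
    and t^(p - r) sums geometrically. With r = p it would count the levels between e and 2 |f(x)|,
    with no bound uniform in e. Lebesgue measure is given as an outer measure on coverings by boxes,
    so volumes and measurability are derived from that definition. *)

Lemma lebesgue_measure_itvcc (R : realType) (a b : R) :
  lebesgue_measure `[a, b]%classic = (Num.max 0 (b - a))%:E.
Proof.
rewrite lebesgue_measure_itv /= lte_fin; case: ltP => ab.
  by rewrite -EFinB max_r// subr_ge0 ltW.
by rewrite max_l// subr_le0.
Qed.

(* Integrating out the coordinates one by one. *)
Lemma prod_indic_cover (R : realType) (m : nat) (d : R) (a b : nat -> R)
    (c : nat -> \bar R) (A B : nat -> nat -> R) :
  0 <= d -> (forall k, (0 <= c k)%E) ->
  (forall x : nat -> R,
    ((d * \prod_(i < m) \1_`[a i, b i] (x i))%:E <=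
     \sum_(k <oo) (c k * (\prod_(i < m) \1_`[A k i, B k i] (x i))%:E))%E) ->
  ((d * \prod_(i < m) Num.max 0 (b i - a i))%:E <=
     \sum_(k <oo) (c k * (\prod_(i < m) Num.max 0 (B k i - A k i))%:E))%E.
Proof.
elim: m d c => [|m IHm] d c d0 c0 H.
  have := H (fun=> 0); rewrite !big_ord0.
  by under eq_eseriesr do rewrite big_ord0; under [X in _ -> (_ <= X)%E]eq_eseriesr do rewrite big_ord0.
have max_ge0 (r : R) : 0 <= Num.max 0 r by rewrite le_max lexx.
have prod_ge0 (F G : nat -> R) (x : nat -> R) :
    0 <= \prod_(i < m) \1_`[F i, G i] (x i) :> R.
  by apply: prodr_ge0 => i _; rewrite indicE ler0n.
rewrite big_ord_recr/=.
under eq_eseriesr.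
  by move=> k _; rewrite big_ord_recr/= mulrC EFinM muleA; over.
(* The length of the last side is absorbed into [d] and [c k]; the lemma carries these factors for
   the sake of this induction. *)
rewrite [d * _](_ : _ = (d * Num.max 0 (b m - a m)) *
  \prod_(i < m) Num.max 0 (b i - a i)); last by ring.
apply: IHm => [|k|x]; rewrite ?mulr_ge0// ?mule_ge0 ?lee_fin//.
pose xt t i := if i == m then t else x i : R.
have Hxt t := H (xt t).
have xtE (F G : nat -> R) t : \prod_(i < m.+1) \1_`[F i, G i] (xt t i) =
    \prod_(i < m) \1_`[F i, G i] (x i) * \1_`[F m, G m] t :> R.
  rewrite big_ord_recr/= /xt eqxx; congr (_ * _); apply: eq_bigr => i _.
  by rewrite ltn_eqF.
pose mu := @lebesgue_measure R.
have mI (F G : R) : measurable (`[F, G]%classic : set R) by exact: measurable_itv.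
have int1 (e : \bar R) (F G : R) : (0 <= e)%E ->
    (\int[mu]_t (e * (\1_`[F, G] t)%:E) = e * (Num.max 0 (G - F))%:E)%E.
  move=> e0; rewrite ge0_integralZl//.
  - by rewrite integral_indic// setIT; congr (_ * _)%E; exact: lebesgue_measure_itvcc.
  - by apply/measurable_EFinP; exact: measurable_indic.
rewrite mulrAC EFinM -int1 ?lee_fin ?mulr_ge0//.
have -> : (\sum_(k <oo) (c k * (Num.max 0 (B k m - A k m))%:E *
   (\prod_(i < m) \1_`[A k i, B k i] (x i))%:E) = \int[mu]_t \sum_(k <oo)
  ((c k * (\prod_(i < m) \1_`[A k i, B k i] (x i))%:E) *
    (\1_`[A k m, B k m] t)%:E))%E.
  rewrite integral_nneseries//.
  - by apply: eq_eseriesr => k _; rewrite int1 ?mule_ge0 ?lee_fin// muleAC.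
  - by move=> k; apply: measurable_funeM; apply/measurable_EFinP; exact: measurable_indic.
  - by move=> k t _; rewrite !mule_ge0 ?lee_fin// indicE ler0n.
apply: ge0_le_integral => //.
- by move=> t _; rewrite mule_ge0// ?lee_fin ?mulr_ge0// indicE ler0n.
- by apply: measurable_funeM; apply/measurable_EFinP; exact: measurable_indic.
- apply: ge0_emeasurable_sum => [k t _ _|k _].
  + by rewrite !mule_ge0 ?lee_fin// indicE ler0n.
  + by apply: measurable_funeM; apply/measurable_EFinP; exact: measurable_indic.
- move=> t _; have := Hxt t; rewrite xtE mulrA EFinM => /le_trans; apply.
  by rewrite le_eqVlt; apply/orP; left; apply/eqP; apply: eq_eseriesr => k _;
    rewrite xtE EFinM muleA.
Qed.

Lemma prod_indic_box (R : realType) (n : nat) (a b : 'rV[R]_n.+1) (x : nat -> R) :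
  \prod_(i < n.+1) \1_`[a 0 (inord i), b 0 (inord i)] (x i) =
  \1_(box a b) (\row_(i < n.+1) x i) :> R.
Proof.
rewrite indicE; have [xab|xab] := boolP (_ \in box a b).
  rewrite big1// => i _; rewrite indicE mem_set//= in_itv/= inord_val.
  by move: xab; rewrite inE => /(_ i); rewrite mxE.
apply/eqP; rewrite prodf_seq_eq0; apply/hasP.
have : ~ box a b (\row_(i < n.+1) x i) by move=> h; move: xab; rewrite mem_set.
move/existsNP => [i hi]; exists i; rewrite ?mem_index_enum//= indicE memNset//=.
by rewrite in_itv/= inord_val => h; apply: hi; rewrite mxE.
Qed.

(** The lower bound integrates the pointwise inequality between the indicator of the box and the sum
    of the indicators of a cover, in place of the usual compactness argument. For the upper bound
    the box covers itself; the cover is filled up with the degenerate box [(0, 0)], whose volume is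
    0. *)
Lemma lebesgue_outer_box (R : realType) (n : nat) (a b : 'rV[R]_n.+1) :
  lebesgue_outer (box a b) = (box_vol a b)%:E.
Proof.
apply/eqP; rewrite eq_le; apply/andP; split.
  apply: ereal_inf_lbound; exists (fun k => if k == 0%N then (a, b) else (0, 0)).
    by move=> x abx; exists 0%N.
  rewrite nneseries_recl//=; last by move=> k _; rewrite lee_fin box_vol_ge0.
  rewrite eseries0 ?adde0// => -[//|k] _ _ /=; congr (_%:E).
  by apply/eqP; rewrite prodf_seq_eq0; apply/hasP; exists ord0;
    rewrite ?mem_index_enum// !mxE subrr maxxx eqxx.
apply: le_ereal_inf_tmp => _ [B abB <-].
pose co (v : 'rV[R]_n.+1) i := v 0 (inord i).
have volE (v w : 'rV[R]_n.+1) :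
    \prod_(i < n.+1) Num.max 0 (co w i - co v i) = box_vol v w.
  by apply: eq_bigr => i _; rewrite /co inord_val.
have := @prod_indic_cover R n.+1 1 (co a) (co b) (fun=> 1%E) (fun k => co (B k).1)
  (fun k => co (B k).2) ler01 (fun=> lee01).
rewrite mul1r volE; under [X in _ -> (_ <= X)%E]eq_eseriesr do rewrite mul1e volE.
apply=> x; rewrite mul1r prod_indic_box.
under eq_eseriesr do rewrite mul1e prod_indic_box.
rewrite indicE; have [|_] := boolP (_ \in box a b); last first.
  by apply: nneseries_ge0 => k _ _; rewrite lee_fin indicE ler0n.
rewrite inE => /abB[k _ xk].
apply: (@le_trans _ _ (\sum_(k <= i < k.+1) (\1_(box (B i).1 (B i).2) (\row_i x i))%:E)%E).
  by rewrite big_nat1 indicE mem_set.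
apply: (@le_trans _ _ (\sum_(0 <= i < k.+1) (\1_(box (B i).1 (B i).2) (\row_i x i))%:E)%E).
  rewrite [leRHS](@big_cat_nat _ _ _ k)//= leeDr//; apply: sume_ge0 => i _.
  by rewrite lee_fin.
by apply: nneseries_lim_ge => i _ _; rewrite lee_fin indicE ler0n.
Qed.

(** The hyperplane x_i = c cuts every box of a cover into two boxes whose volumes add up to the
    volume of that box, which is Caratheodory's criterion. The truncation in [box_vol] keeps the
    identity true for boxes that the hyperplane misses. *)
Lemma measurable_le_coord (R : realType) (n : nat) (i : 'I_n.+1) (c : R) :
  measurable ([set x | x 0 i <= c] : set (lebesgue_space R n)).
Proof.
apply: le_caratheodory_measurable => X; set H := [set x | _].
apply: le_ereal_inf_tmp => _ [B XB <-].
pose up (b : 'rV[R]_n.+1) : 'rV[R]_n.+1 :=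
  \row_j (if j == i then Num.min (b 0 j) c else b 0 j).
pose lo (a : 'rV[R]_n.+1) : 'rV[R]_n.+1 :=
  \row_j (if j == i then Num.max (a 0 j) c else a 0 j).
have split_vol a b : box_vol a b = box_vol a (up b) + box_vol (lo a) b.
  rewrite /box_vol (bigD1 i)//= [X in _ = X + _](bigD1 i)//=.
  rewrite [X in _ = _ + X](bigD1 i)//= !mxE eqxx.
  rewrite [X in _ = _ * X + _](eq_bigr (fun j => Num.max 0 (b 0 j - a 0 j))); last first.
    by move=> j /negPf ji; rewrite mxE ji.
  rewrite [X in _ = _ + _ * X](eq_bigr (fun j => Num.max 0 (b 0 j - a 0 j))); last first.
    by move=> j /negPf ji; rewrite mxE ji.
  rewrite -mulrDl; congr (_ * _); rewrite /Num.max /Num.min.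
  by case: (ltP (b 0 i) c) => ?; case: (ltP (a 0 i) c) => ?; do ![case: ltP => ?]; lra.
have covI (Y : set 'rV[R]_n.+1) (B' : nat -> 'rV[R]_n.+1 * 'rV[R]_n.+1) :
    Y `<=` \bigcup_k box (B' k).1 (B' k).2 ->
    (lebesgue_outer Y <= \sum_(k <oo) (box_vol (B' k).1 (B' k).2)%:E)%E.
  by move=> YB; apply: ereal_inf_lbound; exists B'.
under eq_eseriesr do rewrite split_vol EFinD.
rewrite nneseriesD; last 2 first.
- by move=> k _; rewrite lee_fin box_vol_ge0.
- by move=> k _; rewrite lee_fin box_vol_ge0.
apply: leeD.
- apply: (covI _ (fun k => ((B k).1, up (B k).2))) => x [/XB[k _ /= xk] Hx].
  exists k => //= j; rewrite mxE; have /andP[aj bj] := xk j; rewrite aj/=.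
  by case: eqP => // ->; rewrite le_min Hx andbT; have /andP[] := xk i.
- apply: (covI _ (fun k => (lo (B k).1, (B k).2))) => x [/XB[k _ /= xk] Hx].
  exists k => //= j; rewrite mxE; have /andP[aj bj] := xk j; rewrite bj/= andbT.
  case: eqP => // ->; rewrite ge_max; have /andP[->/= _] := xk i.
  by rewrite ltW// ltNge; apply/negP.
Qed.

Lemma measurable_ge_coord (R : realType) (n : nat) (i : 'I_n.+1) (c : R) :
  measurable ([set x | c <= x 0 i] : set (lebesgue_space R n)).
Proof.
have E : [set x : 'rV[R]_n.+1 | c <= x 0 i] =
    ~` \bigcup_k [set x : 'rV[R]_n.+1 | x 0 i <= c - k.+1%:R^-1].
  apply/seteqP; split => x /=.
    by move=> cx [k _ /=]; rewrite leNgt => /negP; apply;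
      rewrite (lt_le_trans _ cx)// ltrBlDr ltrDl invr_gt0 ltr0n.
  move=> h; rewrite leNgt; apply/negP => xc; apply: h.
  have [k hk] := ltr_add_invr xc.
  by exists k => //=; rewrite lerBrDr ltW.
rewrite [X in measurable X]E; apply: measurableC; apply: bigcup_measurable => k _.
exact: measurable_le_coord.
Qed.

Lemma measurable_box (R : realType) (n : nat) (a b : 'rV[R]_n.+1) :
  measurable (box a b : set (lebesgue_space R n)).
Proof.
(* The intersection runs over all natural numbers; [inord] sends those above n to coordinate 0 and
   so only repeats a condition. *)
rewrite (_ : box a b = \bigcap_k
  ([set x : 'rV[R]_n.+1 | a 0 (inord k) <= x 0 (inord k)] `&`
   [set x | x 0 (inord k) <= b 0 (inord k)])); last first.
  apply/seteqP; split => x.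
    by move=> abx k _; have /andP[] := abx (inord k).
  by move=> h i; have [] := h i I; rewrite /= inord_val => -> ->.
apply: bigcapT_measurable => k; apply: measurableI.
- exact: measurable_ge_coord.
- exact: measurable_le_coord.
Qed.

Lemma mx_norm_le (R : realType) (m n : nat) (x : 'M[R]_(m, n)) (l : R) : 0 <= l ->
  (`|x| <= l) <-> forall i j, `|x i j| <= l.
Proof.
move=> l0; split=> [xl i j|xl].
  apply: le_trans xl; rewrite [leRHS]/Num.norm/= mx_normrE.
  by apply/bigmax_geP; right => /=; exists (i, j).
by rewrite [leLHS]/Num.norm/= mx_normrE; apply/bigmax_leP; split => // -[i j] _; exact: xl.
Qed.

Lemma cube_box (R : realType) (n : nat) (x : 'rV[R]_n.+1) (l : R) : 0 <= l ->
  cube x l = box (x - const_mx l) (x + const_mx l).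
Proof.
move=> l0; apply/seteqP; split => y.
  move=> /(mx_norm_le _ l0) h i; have := h 0 i; rewrite !mxE ler_norml; lra.
by move=> h; apply/(mx_norm_le _ l0) => i j; have := h j; rewrite ord1 !mxE ler_norml; lra.
Qed.

Lemma measurable_cube (R : realType) (n : nat) (x : 'rV[R]_n.+1) (l : R) :
  measurable (cube x l : set (lebesgue_space R n)).
Proof.
have [l0|l0] := leP 0 l; first by rewrite cube_box//; exact: measurable_box.
rewrite (_ : cube x l = set0); first exact: measurable0.
by rewrite -subset0 => y /= /(le_trans (normr_ge0 _)); rewrite leNgt l0.
Qed.

Lemma lebesgue_cube (R : realType) (n : nat) (x : 'rV[R]_n.+1) (l : R) : 0 <= l ->
  lebesgue (cube x l) = ((2 * l) ^+ n.+1)%:E.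
Proof.
move=> l0; rewrite /lebesgue cube_box// lebesgue_outer_box /box_vol.
rewrite (eq_bigr (fun=> 2 * l)) ?prodr_const ?card_ord// => i _.
by rewrite !mxE max_r; lra.
Qed.

Lemma compact_cube (R : realType) (n : nat) (x : 'rV[R]_n.+1) (l : R) : compact (cube x l).
Proof.
apply: bounded_closed_compact; last exact: closed_closed_ball_.
exists (`|x| + l); split; first exact: num_real.
move=> M xlM y /= xyl; rewrite -[y](subKr x) (le_trans (ler_normB _ _))//.
by rewrite (le_trans _ (ltW xlM))// lerD2l.
Qed.

Lemma cube_sub (R : realType) (n : nat) (x y : 'rV[R]_n.+1) (r s : R) :
  `|x - y| + r <= s -> cube y r `<=` cube x s.
Proof.
rewrite /cube /closed_ball_ => xyrs z /= yzr; rewrite (le_trans _ xyrs)//.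
have -> : x - z = (x - y) + (y - z) by rewrite addrA subrK.
by rewrite (le_trans (ler_normD _ _))// lerD2l.
Qed.

Lemma cube_center (R : realType) (n : nat) (x : 'rV[R]_n.+1) (r : R) : 0 <= r -> cube x r x.
Proof. by rewrite /cube/closed_ball_/= subrr normr0. Qed.

(** * Distance, grids and countable covers *)

Lemma dist_to_le (R : realType) (n : nat) (x y : 'rV[R]_n.+1) (A : set 'rV[R]_n.+1) :
  A y -> dist_to x A <= `|x - y|.
Proof.
by move=> Ay; apply: ge_inf; [exists 0 => _ [z _ <-]|exists y].
Qed.

Lemma dist_to_lip (R : realType) (n : nat) (x y : 'rV[R]_n.+1) (A : set 'rV[R]_n.+1) :
  A !=set0 -> dist_to x A <= dist_to y A + `|x - y|.
Proof.
move=> [a Aa]; rewrite -lerBlDr; apply: lb_le_inf; first by exists `|y - a|, a.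
move=> _ [z Az <-]; rewrite lerBlDr (le_trans (dist_to_le x Az))//.
have -> : x - z = (y - z) + (x - y) by rewrite [RHS]addrC addrA subrK.
exact: ler_normD.
Qed.

Lemma dist_to_gt0 (R : realType) (n : nat) (x : 'rV[R]_n.+1) (Omega : set 'rV[R]_n.+1) :
  open Omega -> ~` Omega !=set0 -> Omega x -> 0 < dist_to x (~` Omega).
Proof.
move=> oO [a Oa] Ox; have : nbhs x Omega by exact: open_nbhs_nbhs.
move=> /nbhs_ballP[e /= e0 eO]; apply: (lt_le_trans e0).
apply: lb_le_inf; first by exists `|x - a|, a.
move=> _ [z Oz <-]; rewrite leNgt; apply/negP => xze; apply: Oz; apply: eO.
by rewrite -ball_normE.
Qed.

Lemma cube_sub_Omega (R : realType) (n : nat) (x : 'rV[R]_n.+1) (l : R)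
    (Omega : set 'rV[R]_n.+1) :
  l < dist_to x (~` Omega) -> cube x l `<=` Omega.
Proof.
move=> ld y; rewrite /cube/closed_ball_/= => xyl; apply: contrapT => Oy.
by have := @dist_to_le R n x y (~` Omega) Oy; rewrite leNgt (le_lt_trans xyl ld).
Qed.

(** The points are the midpoints of the N + 1 equal parts of [-l, l]; k is the first part whose
    right end is at least t. *)
Lemma grid1 (R : realType) (N : nat) (l t : R) : `|t| <= l ->
  exists k : 'I_N.+1, `|t - l * (2 * k%:R + 1 - N.+1%:R) / N.+1%:R| <= l / N.+1%:R.
Proof.
move=> tl; have [tl1 tl2] : - l <= t /\ t <= l by move: tl; rewrite ler_norml => /andP[].
have N0 : 0 < N.+1%:R :> R by rewrite ltr0n.
have exP : exists k : nat, (t + l) * N.+1%:R <= 2 * l * k.+1%:R.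
  by exists N; rewrite ler_pM2r//; lra.
case: (ex_minnP exP) => k Pk kmin.
have kN : (k <= N)%N by apply: kmin; rewrite ler_pM2r//; lra.
have lowk : 2 * l * k%:R <= (t + l) * N.+1%:R.
  case: k Pk kmin kN => [|k] Pk kmin kN; first by rewrite mulr0 mulr_ge0//; lra.
  rewrite leNgt; apply/negP => /ltW /kmin; by rewrite ltnn.
exists (Ordinal (kN : (k < N.+1)%N)) => /=.
have -> : t - l * (2 * k%:R + 1 - N.+1%:R) / N.+1%:R =
  ((t + l) * N.+1%:R - 2 * l * k%:R - l) / N.+1%:R by field; rewrite gt_eqF.
rewrite normrM (gtr0_norm (_ : 0 < N.+1%:R^-1)) ?invr_gt0//.
rewrite ler_pM2r ?invr_gt0// ler_norml; move: Pk lowk; rewrite -[k.+1%:R]natr1; lra.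
Qed.

(** Serves both to count separated points and to cover a cube by boundedly many small ones: the
    number of cells depends only on n and N, not on l. *)
Lemma grid (R : realType) (n N : nat) (x : 'rV[R]_n.+1) (l : R) : 0 <= l ->
  exists y : {ffun 'I_n.+1 -> 'I_N.+1} -> 'rV[R]_n.+1,
    (forall k, cube x l (y k)) /\
    cube x l `<=` \bigcup_k cube (y k) (l / N.+1%:R).
Proof.
move=> l0.
pose off (k : 'I_N.+1) : R := l * (2 * k%:R + 1 - N.+1%:R) / N.+1%:R.
exists (fun k => \row_i (x 0 i + off (k i))); split.
  move=> k; apply/(mx_norm_le _ l0) => i j; rewrite ord1 !mxE opprD addrA subrr add0r.
  rewrite normrN /off -mulrA normrM (ger0_norm l0) ler_piMr//.
  rewrite normrM (gtr0_norm (_ : 0 < N.+1%:R^-1)) ?invr_gt0 ?ltr0n//.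
  rewrite ler_pdivrMr ?ltr0n// mul1r ler_norml.
  have : (k j)%:R <= N%:R :> R by rewrite ler_nat -ltnS.
  by have := ler0n R (k j); rewrite -[N.+1%:R]natr1; lra.
move=> z /(mx_norm_le _ l0) xz.
have xz' i : `|z 0 i - x 0 i| <= l by rewrite distrC; have := xz 0 i; rewrite !mxE.
have [k hk] := choice (fun i => grid1 N (xz' i)).
exists [ffun i => k i] => //; apply/mx_norm_le; first by rewrite divr_ge0// ler0n.
by move=> i j; rewrite ord1 !mxE ffunE distrC opprD addrA; exact: hk.
Qed.

(** The cubes with rational center and half side are enumerated, and those that fail [P] are
    replaced by the empty cube of half side -1. The predicate [P] lets each cube of the cover retain
    a property, such as a radius common to all its points. *)
Lemma lindelof (R : realType) (n : nat) (S : set 'rV[R]_n.+1)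
    (P : set 'rV[R]_n.+1 -> Prop) :
  P set0 ->
  (forall x, S x -> exists2 rho, 0 < rho &
     forall y r, cube y r `<=` cube x rho -> P (cube y r)) ->
  exists (c : nat -> 'rV[R]_n.+1) (r : nat -> R),
    (forall i, P (cube (c i) (r i))) /\ S `<=` \bigcup_i cube (c i) (r i).
Proof.
move=> P0 SP.
pose dec i : 'rV[R]_n.+1 * R :=
  if unpickle i is Some (a, s) then
    let a' := map_mx (@ratr R) (a : 'rV[rat]_n.+1) in
    if `[< P (cube a' (ratr s)) >] then (a', ratr (s : rat)) else (0, -1)
  else (0, -1).
have cubeN1 : @cube R n 0 (-1) = set0.
  by rewrite -subset0 => y /= /(le_trans (normr_ge0 _)); rewrite oppr_ge0 ler10.
exists (fun i => (dec i).1), (fun i => (dec i).2); split.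
  move=> i; rewrite /dec; case: unpickle => [[a s]|/=]; last by rewrite cubeN1.
  by case: ifPn => [/asboolP//|_ /=]; rewrite cubeN1.
move=> x /SP[rho rho0 Prho].
(* Half of [rho], because a cube of half side s whose center is within s of x reaches up to 2 s away
   from x. *)
have [s /andP[s0 srho]] : exists s : rat, (0 : R) < ratr s < rho / 2.
  have [s] := rat_in_itvoo (divr_gt0 rho0 (ltr0Sn R 1)).
  by rewrite in_itv/= => h; exists s.
have /choice[a ha] : forall i, exists a : rat, `|ratr a - x 0 i| <= ratr s :> R.
  move=> i; have : x 0 i < x 0 i + ratr s by rewrite ltrDl.
  move=> /rat_in_itvoo[a]; rewrite in_itv/= => /andP[h1 h2]; exists a.
  by rewrite ger0_norm ?subr_ge0 ?ltW// ltrBlDl.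
pose a' := map_mx (@ratr R) (\row_i a i).
have ax : `|a' - x| <= ratr s.
  by apply/mx_norm_le; [exact: ltW|move=> i j; rewrite ord1 !mxE].
exists (pickle (\row_i a i, s)) => //; rewrite /dec pickleK /=.
case: ifPn => [_ //|/asboolPn[]]; apply: Prho; apply: cube_sub.
by rewrite distrC; lra.
Qed.

Lemma measurable_open_rV (R : realType) (n : nat) (O : set 'rV[R]_n.+1) :
  open O -> measurable (O : set (lebesgue_space R n)).
Proof.
move=> oO; have [//|x Ox|c [r [crO Ocr]]] := @lindelof R n O (fun A => A `<=` O).
  have /nbhs_ballP[e /= e0 eO] : nbhs x O by exact: open_nbhs_nbhs.
  exists (e / 2); first exact: divr_gt0.
  move=> y r /subset_trans; apply; move=> z xz; apply: eO; rewrite -ball_normE /=.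
  by apply: le_lt_trans xz _; lra.
rewrite (_ : O = \bigcup_i cube (c i) (r i)).
  by apply: bigcup_measurable => i _; exact: measurable_cube.
by apply/seteqP; split => // x [i _]; exact: crO.
Qed.

(** * Besicovitch covering *)

(** Relates a center x to one selected later: the radius does not increase and the cube of x misses
    the later center. *)
Definition besicovitch_rel (R : realType) (n : nat) (l : 'rV[R]_n.+1 -> R) :=
  [rel x y : 'rV[R]_n.+1 | (l y <= l x) && (l x < `|x - y|)].

(** The set [U] may be infinite, but only finitely many radii occur, so the largest one is attained
    exactly and not just up to a factor. *)
Lemma exists_max_finite_range (R : realType) (T : Type) (l : T -> R) (L : seq R)
    (U : set T) :
  U !=set0 -> (forall u, U u -> l u \in L) ->
  exists2 u, U u & forall w, U w -> l w <= l u.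
Proof.
elim: L U => [|s L IHL] U [u0 Uu0] UL; first by have := UL _ Uu0; rewrite in_nil.
have [[u [Uu us]]|noU] := pselect (exists u, U u /\ s < l u).
  have [||w [Uw sw] wmax] := IHL [set w | U w /\ s < l w].
  - by exists u.
  - by move=> w [/UL]; rewrite inE => /orP[/eqP ->|//]; rewrite ltxx.
  exists w => // z Uz; have [zs|sz] := leP (l z) s; last exact: wmax.
  by rewrite (le_trans zs)// ltW.
have les w : U w -> l w <= s.
  by move=> Uw; rewrite leNgt; apply/negP => sw; apply: noU; exists w.
have [[u [Uu us]]|noUs] := pselect (exists u, U u /\ l u = s).
  by exists u => // w /les; rewrite us.
apply: IHL; first by exists u0.
move=> w Uw; have := UL _ Uw; rewrite inE => /orP[/eqP ws|//].
by exfalso; apply: noUs; exists w.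
Qed.

Lemma pos_lower_bound (R : realType) (L : seq R) :
  exists2 e : R, 0 < e & forall s, s \in L -> 0 < s -> e <= s.
Proof.
elim: L => [|s L [e e0 eL]]; first by exists 1.
have [s0|s0] := ltP 0 s; last first.
  exists e => // t; rewrite inE => /orP[/eqP ->|]; last exact: eL.
  by rewrite ltNge s0.
exists (Num.min e s); first by rewrite lt_min e0.
by move=> t; rewrite inE ge_min => /orP[/eqP ->|tL t0]; rewrite ?lexx ?orbT ?eL.
Qed.

(** The counting device of this part: labels in a finite type that tell related elements apart bound
    the length of the sequence. The labels are grid cells first, orthants later. *)
Lemma uniq_map_pairwise (T1 T2 : eqType) (P : {pred T1}) (r : rel T1) (g : T1 -> T2)
    (s : seq T1) :
  {in P &, forall x y, r x y -> g x != g y} -> all P s -> pairwise r s ->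
  uniq (map g s).
Proof.
by move=> rg Ps rs; rewrite uniq_pairwise pairwise_map; apply: (sub_in_pairwise rg Ps).
Qed.

(** Related centers are more than e apart, whereas two points of one grid cell are at most 2 M / (N
    + 1) < e apart. This is what makes the greedy selection stop. *)
Lemma separated_size_bound (R : realType) (n : nat) (A : set 'rV[R]_n.+1)
    (l : 'rV[R]_n.+1 -> R) (e M : R) :
  0 < e -> 0 <= M -> (forall x, A x -> e <= l x) -> A `<=` cube 0 M ->
  exists N, forall xs : seq 'rV[R]_n.+1, (forall x, x \in xs -> A x) ->
    pairwise (besicovitch_rel l) xs -> (size xs <= N)%N.
Proof.
move=> e0 M0 eA AM.
have [N HN] : exists N : nat, 2 * M / e < N.+1%:R.
  by exists (Num.truncn (2 * M / e)); exact: truncnS_gt.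
have [y [_ My]] := @grid R n N 0 M M0.
have /choice[k hk] : forall x, exists k, A x -> cube (y k) (M / N.+1%:R) x.
  move=> x; have [Ax|nAx] := pselect (A x); last by exists [ffun=> ord0].
  by have [k _ yk] := My _ (AM _ Ax); exists k.
exists #|{: {ffun 'I_n.+1 -> 'I_N.+1}}| => xs xsA xsr.
have : uniq (map k xs).
  apply: (@uniq_map_pairwise _ _ (mem xs)) xsr; last by apply/allP.
  move=> x x' xx xx' /andP[_ /= lt]; apply/eqP => kk.
  have h := hk _ (xsA _ xx); have h' := hk _ (xsA _ xx').
  move: lt; rewrite ltNge => /negP; apply; apply: le_trans (eA _ (xsA _ xx)).
  have -> : x - x' = (y (k x) - x') - (y (k x) - x) by rewrite opprB [RHS]addrC addrA subrK.
  rewrite (le_trans (ler_normB _ _))//; rewrite {1}kk.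
  apply: (le_trans (lerD h' h)).
  have N0 : 0 < N.+1%:R :> R by rewrite ltr0n.
  rewrite -mulrDl ler_pdivrMr// mulrC.
  by move: HN; rewrite ltr_pdivrMr// => /ltW; rewrite mulrDl mul1r mulrC.
by move=> /card_uniqP; rewrite size_map => <-; exact: max_card.
Qed.

(* Picking at each step an uncovered point with the largest radius. *)
Lemma besicovitch_selection (R : realType) (n : nat) (A : set 'rV[R]_n.+1)
    (l : 'rV[R]_n.+1 -> R) (L : seq R) (M : R) :
  0 <= M -> A `<=` cube 0 M -> (forall x, A x -> 0 < l x /\ l x \in L) ->
  exists xs : seq 'rV[R]_n.+1,
    [/\ forall x, x \in xs -> A x, pairwise (besicovitch_rel l) xs &
        forall y, A y -> exists2 x, x \in xs & cube x (l x) y].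
Proof.
move=> M0 AM AL; have [e e0 eL] := pos_lower_bound L.
have [N HN] := @separated_size_bound R n A l e M e0 M0
  (fun x Ax => eL _ (AL _ Ax).2 (AL _ Ax).1) AM.
pose unc (xs : seq 'rV[R]_n.+1) y := A y /\ forall x, x \in xs -> ~ cube x (l x) y.
(* If no selected sequence covers [A], the selection continues beyond the length [N]. The invariant
   that uncovered points have radii at most those already selected makes each new center related to
   all earlier ones. *)
apply: contrapT => nocov.
suff /(_ N.+1)[xs [xsA xsr _ /eqP]] : forall m, exists xs : seq 'rV[R]_n.+1,
    [/\ forall x, x \in xs -> A x, pairwise (besicovitch_rel l) xs,
        forall y, unc xs y -> forall x, x \in xs -> l y <= l x & size xs = m].
  by apply/negP; rewrite neq_ltn ltnS HN.
elim=> [|m [xs [xsA xsr xsg xsm]]]; first by exists [::].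
have unc0 : unc xs !=set0.
  apply: contrapT => h; apply: nocov; exists xs; split => // y Ay.
  apply: contrapT => h'; apply: h; exists y; split => // x xxs xy; apply: h'.
  by exists x.
have [y [Ay xsy] ymax] := @exists_max_finite_range R _ l L _ unc0
  (fun u (Uu : unc xs u) => (AL _ Uu.1).2).
exists (rcons xs y); split; last by rewrite size_rcons xsm.
- by move=> x; rewrite mem_rcons inE => /orP[/eqP ->|/xsA].
- rewrite pairwise_rcons xsr andbT; apply/allP => x xxs /=.
  rewrite (xsg y)//=; have := xsy x xxs; rewrite /cube/closed_ball_/=.
  by rewrite ltNge => /negP.
- move=> z [Az xsz] x; rewrite mem_rcons inE => /orP[/eqP ->|xxs].
    by apply: ymax; split => // w wxs; apply: xsz; rewrite mem_rcons inE wxs orbT.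
  by apply: xsg => //; split => // w wxs; apply: xsz; rewrite mem_rcons inE wxs orbT.
Qed.

(* Two selected cubes containing y cannot have their centers in the same orthant
   around y: the larger one would contain the center of the smaller one. *)
Lemma besicovitch_overlap (R : realType) (n : nat) (l : 'rV[R]_n.+1 -> R)
    (xs : seq 'rV[R]_n.+1) (y : 'rV[R]_n.+1) :
  pairwise (besicovitch_rel l) xs ->
  (count (fun x => (`|x - y| <= l x)%R) xs <= 2 ^ n.+1)%N.
Proof.
move=> xsr; rewrite -size_filter; set P := fun x => _.
pose sg (x : 'rV[R]_n.+1) := [ffun i => x 0 i <= y 0 i].
have : uniq (map sg (seq.filter P xs)).
  apply: (@uniq_map_pairwise _ _ P (besicovitch_rel l)).
  - move=> x x'; rewrite !unfold_in /P => Px Px' /andP[/= ll lt]; apply/eqP => sgE.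
    have l0 : 0 <= l x by exact: le_trans Px.
    have l0' : 0 <= l x' by exact: le_trans Px'.
    (* In each coordinate x and x' lie on the same side of y, so their difference is at most the
       larger of their distances to y, hence at most l x because l x' <= l x. *)
    move: lt; rewrite ltNge => /negP; apply; apply/(mx_norm_le _ l0) => i j.
    rewrite ord1; move: Px Px' => /(mx_norm_le _ l0)/(_ 0 j) + /(mx_norm_le _ l0')/(_ 0 j).
    move/ffunP/(_ j): sgE; rewrite !ffunE !mxE !ler_norml.
    by case: (leP (x 0 j)) => h; case: (leP (x' 0 j)) => // h' _; lra.
  - by rewrite all_filter; apply/allP => x _ /=; apply/implyP.
  - by apply: subseq_pairwise xsr; exact: filter_subseq.
move=> /card_uniqP; rewrite size_map => <-; rewrite (leq_trans (max_card _))//.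
by rewrite card_ffun card_bool card_ord.
Qed.

(** * Reverse Hoelder and weighted Hoelder inequalities *)

Lemma dyadic_level (R : realType) (m t : R) : 0 < m -> m < t ->
  exists k, m * 2 ^+ k < t <= m * 2 ^+ k.+1.
Proof.
move=> m0 mt; have exP : exists k : nat, t <= m * 2 ^+ k.+1.
  exists (Num.truncn (t / m)); rewrite mulrC -ler_pdivrMr//.
  rewrite (le_trans (ltW (truncnS_gt _)))// -natrX ler_nat.
  by rewrite ltnW// ltn_expl.
case: (ex_minnP exP) => k Pk kmin; exists k; rewrite Pk andbT.
case: k kmin {Pk} => [|k] kmin; first by rewrite expr0 mulr1.
by rewrite ltNge; apply/negP => /kmin; rewrite ltnn.
Qed.

Lemma geometric_sum_le (R : realType) (z : R) (N : nat) : 0 <= z < 1 ->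
  \sum_(0 <= k < N) z ^+ k <= (1 - z)^-1.
Proof.
move=> /andP[z0 z1]; have z1' : 0 < 1 - z by rewrite subr_gt0.
rewrite -[leRHS]mul1r ler_pdivlMr// mulrC big_mkord -[1 - z]opprB mulNr -subrX1 opprB.
by rewrite lerBlDr lerDl exprn_ge0.
Qed.

Lemma nneseries_le (R : realType) (u : nat -> \bar R) (B : \bar R) :
  (forall k, 0 <= u k)%E -> (forall N, \sum_(0 <= k < N) u k <= B)%E ->
  (\sum_(k <oo) u k <= B)%E.
Proof.
move=> u0 uB; apply: lime_le; first exact: is_cvg_nneseries.
exact: nearW.
Qed.

Lemma poweR_le (R : realType) (r : R) (x y : \bar R) :
  0 <= r -> (0 <= x)%E -> (x <= y)%E -> (x `^ r <= y `^ r)%E.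
Proof.
move=> r0 x0 xy; apply: gt0_ler_poweR => //; rewrite in_itv/= leey andbT//.
exact: le_trans xy.
Qed.

Lemma powR_le (R : realType) (r x y : R) : 0 <= r -> 0 <= x -> x <= y ->
  x `^ r <= y `^ r.
Proof.
by move=> r0 x0 xy; apply: ge0_ler_powR => //; rewrite nnegrE//; exact: le_trans xy.
Qed.

Lemma powR_exprn (R : realType) (x e : R) (k : nat) : 0 <= x ->
  (x ^+ k) `^ e = (x `^ e) ^+ k.
Proof.
move=> x0; elim: k => [|k IHk]; first by rewrite !expr0 powR1.
by rewrite !exprS powRM ?exprn_ge0// IHk.
Qed.

Lemma poweRS (R : realType) (r : R) (x : \bar R) :
  0 <= r -> (0 <= x)%E -> (x `^ (1 + r) = x * x `^ r)%E.
Proof.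
by move=> r0 x0; rewrite poweRD ?poweRe1//; apply: add_neq0_poweRD_def; lra.
Qed.

(* The level sets {w > 2^k m}, m the mean of w, have measure at most 2^-k V, so
   that the hypothesis bounds their w-mass geometrically. *)
Lemma reverse_hoelder d (T : measurableType d) (R : realType)
    (mu : {measure set T -> \bar R}) (Q : set T) (w : T -> \bar R) (V W c eta : R) :
  measurable Q -> measurable_fun Q w -> (forall x, Q x -> 0 <= w x)%E ->
  0 < V -> 0 <= W -> 0 <= c -> 0 < eta ->
  mu Q = V%:E -> (\int[mu]_(x in Q) w x = W%:E)%E ->
  (forall E e, measurable E -> E `<=` Q -> 0 <= e -> (mu E <= (e * V)%:E)%E ->
     (\int[mu]_(x in E) w x <= (c * e `^ (2 * eta) * W)%:E)%E) ->
  (\int[mu]_(x in Q) w x `^ (1 + eta) <=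
     ((1 + c * 2 `^ eta / (1 - 2 `^ (- eta))) * V * (W / V) `^ (1 + eta))%:E)%E.
Proof.
move=> mQ mw w0 V0 W0 c0 eta0 muQ intw hA.
have eta1 : 1 + eta != 0 by lra.
have mws : measurable_fun Q (fun x => w x `^ (1 + eta))%E.
  by apply: (measurableT_comp (measurable_poweR _)).
have [W00|Wn0] := eqVneq W 0.
  rewrite W00 mul0r powR0// mulr0.
  have w_ae : ae_eq mu Q w (cst 0%E).
    apply/(ae_eq_integral_abs mu mQ mw); rewrite -[RHS]/(0%:E) -W00 -intw.
    by apply: eq_integral => x; rewrite inE => Qx; rewrite gee0_abs// w0.
  rewrite (@ge0_ae_eq_integral _ _ _ mu Q _ (cst 0%E))//; first by rewrite integral0.
  - by move=> x Qx; exact: poweR_ge0.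
  - by case: w_ae => N [mN N0 subN]; exists N; split => // x /= h; apply: subN => /=;
      move=> h'; apply: h => Qx; rewrite (h' Qx) /cst poweR0r.
have {W0 Wn0} W0 : 0 < W by rewrite lt_neqAle eq_sym Wn0.
set m := W / V; have m0 : 0 < m by rewrite divr_gt0.
pose E k := Q `&` [set x | (m * 2 ^+ k)%:E < w x]%E.
have mE k : measurable (E k) by exact: emeasurable_fun_o_infty.
have EQ k : E k `<=` Q by exact: subIsetl.
have p2 k : 0 < 2 ^+ k :> R by rewrite exprn_gt0.
(* Chebyshev's inequality, with W = m V. *)
have muE k : (mu (E k) <= ((2 ^+ k)^-1 * V)%:E)%E.
  have : ((m * 2 ^+ k)%:E * mu (E k) <= W%:E)%E.
    rewrite -intw -integral_cst//; apply: (@le_trans _ _ (\int[mu]_(x in E k) w x)%E).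
      apply: ge0_le_integral => //.
      - by move=> x _; rewrite lee_fin mulr_ge0 ?ltW.
      - exact: measurable_funS mw.
      - by move=> x [_ /= /ltW].
    exact: ge0_subset_integral.
  rewrite -lee_pdivlMl; last exact: mulr_gt0.
  move=> /le_trans; apply.
  rewrite -EFinM lee_fin le_eqVlt; apply/orP; left; apply/eqP.
  by rewrite /m; field; rewrite (gt_eqF V0) (gt_eqF W0) expf_neq0 ?pnatr_eq0.
have intE k : (\int[mu]_(x in E k) w x <= (c * W * (2 `^ (- eta)) ^+ (2 * k))%:E)%E.
  apply: le_trans (hA _ ((2 ^+ k)^-1) (mE k) (EQ k) _ (muE k)) _.
    by rewrite invr_ge0 ltW.
  rewrite lee_fin mulrAC; apply: ler_wpM2l; first by rewrite mulr_ge0// ltW.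
  have -> : (2 ^+ k)^-1 `^ (2 * eta) = (2 `^ (- eta)) ^+ (2 * k) :> R; last by [].
  rewrite -[(2 ^+ k)^-1](powR_inv1 (ltW (p2 k))) -powRrM mulN1r powR_exprn//.
  rewrite exprM expr2 -powRD; last by rewrite pnatr_eq0 implybT.
  by congr ((_ `^ _) ^+ _); ring.
pose a k := (m * 2 ^+ k.+1) `^ eta.
have a0 k : 0 < a k by rewrite powR_gt0// mulr_gt0.
(* Where w <= m the first term suffices. Otherwise m 2^k < w <= m 2^(k+1) for some k, so x lies in
   [E k] and w^eta <= a k. A value w x = +oo is absorbed by the first term, as m > 0. *)
have pw x : Q x -> (w x `^ (1 + eta) <=
    (m `^ eta)%:E * w x + \sum_(k <oo) (a k)%:E * (w \_ (E k)) x)%E.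
  move=> Qx; have wx0 := w0 x Qx.
  have t0 k : (0 <= (a k)%:E * (w \_ (E k)) x)%E.
    by apply: mule_ge0; [rewrite lee_fin ltW|rewrite patchE; case: ifP].
  have S0 : (0 <= \sum_(k <oo) (a k)%:E * (w \_ (E k)) x)%E.
    by apply: nneseries_ge0 => k _ _.
  have Sk k : E k x -> ((a k)%:E * w x <= \sum_(k <oo) (a k)%:E * (w \_ (E k)) x)%E.
    move=> Ekx; rewrite (@nneseriesD1 _ _ k)//= patchE mem_set// leeDl//.
    by apply: nneseries_ge0 => j _ _.
  rewrite (poweRS (ltW eta0) wx0); move: wx0 Sk; case wxE : (w x) => [t| |//] wx0 Sk; last first.
    have -> : ((m `^ eta)%:E * +oo = +oo :> \bar R)%E.
      by rewrite gt0_muley// lte_fin powR_gt0.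
    by rewrite addye ?leey// gt_eqF// (lt_le_trans _ S0)// ltNy0.
  rewrite lee_fin in wx0.
  have [tm|mt] := leP t m.
    apply: (@le_trans _ _ ((m `^ eta)%:E * t%:E)%E); last by rewrite leeDl.
    rewrite poweR_EFin -!EFinM lee_fin mulrC ler_wpM2r//.
    exact: powR_le (ltW eta0) wx0 tm.
  have [k /andP[k1 k2]] := dyadic_level m0 mt.
  apply: (@le_trans _ _ ((a k)%:E * t%:E)%E); last first.
    apply: (le_trans (Sk k _)); first by split => //=; rewrite wxE lte_fin.
    by rewrite leeDr// mule_ge0// lee_fin ?powR_ge0.
  rewrite poweR_EFin -!EFinM lee_fin mulrC ler_wpM2r// /a.
  exact: powR_le (ltW eta0) wx0 k2.
have mwE k : measurable_fun Q (w \_ (E k)).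
  by apply/(measurable_restrict _ (mE k) mQ); rewrite setIidr//; exact: measurable_funS mw.
have wE0 k x : Q x -> (0 <= (w \_ (E k)) x)%E.
  by move=> Qx; rewrite patchE; case: ifP => // _; exact: w0.
apply: (@le_trans _ _ (\int[mu]_(x in Q) ((m `^ eta)%:E * w x +
    \sum_(k <oo) (a k)%:E * (w \_ (E k)) x))%E).
  apply: ge0_le_integral => //.
  - by move=> x _; exact: poweR_ge0.
  - apply: emeasurable_funD; first exact: measurable_funeM.
    apply: ge0_emeasurable_sum => [k x Qx _|k _]; last exact: measurable_funeM.
    by apply: mule_ge0; [rewrite lee_fin ltW|exact: wE0].
rewrite ge0_integralD//; last 4 first.
- by move=> x Qx; apply: mule_ge0; [rewrite lee_fin powR_ge0|exact: w0].
- exact: measurable_funeM.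
- move=> x Qx; apply: nneseries_ge0 => k _ _.
  by apply: mule_ge0; [rewrite lee_fin ltW|exact: wE0].
- apply: ge0_emeasurable_sum => [k x Qx _|k _]; last exact: measurable_funeM.
  by apply: mule_ge0; [rewrite lee_fin ltW|exact: wE0].
rewrite ge0_integralZl ?lee_fin ?powR_ge0// intw integral_nneseries//; last 2 first.
- by move=> k; exact: measurable_funeM.
- by move=> k x Qx; apply: mule_ge0; [rewrite lee_fin ltW|exact: wE0].
have z01 : (0 : R) <= 2 `^ (- eta) < 1.
  rewrite powR_ge0/= powRN invf_lt1 ?powR_gt0//.
  rewrite [ltLHS](_ : _ = 1 `^ eta); last by rewrite powR1.
  by apply: gt0_ltr_powR; rewrite ?nnegrE//; lra.
(* The factor [a k] grows like 2^(eta k) and the mass of [E k] decays like 2^(-2 eta k); the product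
   is a geometric series of ratio 2^(-eta). *)
apply: (@le_trans _ _ ((m `^ eta * W)%:E +
    (m `^ eta * W * (c * 2 `^ eta) * (1 - 2 `^ (- eta))^-1)%:E)%E).
  rewrite leeD2l//; apply: nneseries_le => [k|N].
    by apply: integral_ge0 => x Qx; apply: mule_ge0; [rewrite lee_fin ltW|exact: wE0].
  apply: (@le_trans _ _ (\sum_(0 <= k < N) (m `^ eta * W * (c * 2 `^ eta) *
    (2 `^ (- eta)) ^+ k)%:E)%E).
    apply: lee_sum => k _.
    rewrite ge0_integralZl//; [|by move=> x Qx; exact: wE0|by rewrite lee_fin ltW].
    rewrite -integral_mkcondr setIidr//.
    apply: (@le_trans _ _ ((a k)%:E * (c * W * (2 `^ (- eta)) ^+ (2 * k))%:E)%E).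
      by rewrite lee_wpmul2l// lee_fin ltW.
    rewrite -EFinM lee_fin /a (powRM eta (ltW m0) (ltW (p2 _))) exprS.
    rewrite (powRM eta (ler0n _ 2) (ltW (p2 k))).
    have -> : (2 ^+ k) `^ eta = ((2 `^ (- eta)) ^+ k)^-1 :> R.
      by rewrite powRN exprVn invrK powR_exprn.
    rewrite mul2n -addnn exprD; rewrite le_eqVlt; apply/orP; left; apply/eqP.
    by field; rewrite expf_neq0// gt_eqF// powR_gt0.
  rewrite sumEFin lee_fin -mulr_sumr ler_wpM2l//; last exact: geometric_sum_le.
  by rewrite !mulr_ge0 ?powR_ge0// (ltW W0).
rewrite -EFinD lee_fin powRD; last by rewrite gt_eqF//; lra.
rewrite (powRr1 (ltW m0)); rewrite (_ : W = m * V); last by rewrite /m divfK// gt_eqF.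
by rewrite le_eqVlt; apply/orP; left; apply/eqP; ring.
Qed.

Lemma ge0_integral_fin_ae d (T : measurableType d) (R : realType)
    (mu : {measure set T -> \bar R}) (Q : set T) (w : T -> \bar R) :
  measurable Q -> measurable_fun Q w -> (forall x, Q x -> 0 <= w x)%E ->
  (\int[mu]_(x in Q) w x < +oo)%E ->
  {ae mu, forall x, Q x -> w x \is a fin_num}.
Proof.
move=> mQ mw w0 wfin; apply: integrable_ae => //; apply/integrableP; split => //.
rewrite (_ : (\int[mu]_(x in Q) _ = \int[mu]_(x in Q) w x)%E)//.
by apply: eq_integral => x; rewrite inE => Qx; rewrite gee0_abs// w0.
Qed.

(** Finiteness of the dual weight excludes v x = 0, where its value is +oo. *)
Lemma dual_weight_gt0 (R : realType) (n : nat) (p : R) (v : 'rV[R]_n.+1 -> \bar R) x :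
  1 < p -> (0 <= v x)%E -> v x \is a fin_num -> dual_weight p v x \is a fin_num ->
  exists t : R, [/\ 0 < t, v x = t%:E & dual_weight p v x = (t `^ (- (p - 1)^-1))%:E].
Proof.
move=> p1 v0 /fineK vt; rewrite /dual_weight -vt poweR_EFin inver.
have [//|nz _] := eqVneq; exists (fine (v x)); split => //; last by rewrite powRN.
rewrite lt_neqAle fine_ge0// andbT eq_sym; apply: contra_neq nz => ->.
by rewrite powR0// invr_eq0 gt_eqF// subr_gt0.
Qed.

(** Hoelder's inequality with exponents r and r / (r - 1) for the factors |h| v^(1/r) and w^(a/r):
    almost everywhere w = v^(-1/a), so their product is |h|, and the second factor raised to r / (r
    - 1) is w^s. *)
Lemma weighted_hoelder d (T : measurableType d) (R : realType)
    (mu : {measure set T -> \bar R}) (Q : set T) (h : T -> R) (v w : T -> \bar R)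
    (a r s : R) :
  measurable Q -> measurable_fun Q h ->
  measurable_fun Q v -> measurable_fun Q w ->
  (forall x, Q x -> 0 <= v x)%E -> (forall x, Q x -> 0 <= w x)%E ->
  1 < r -> s = a * (r - 1)^-1 ->
  {ae mu, forall x, Q x -> exists t : R,
    [/\ 0 < t, v x = t%:E & w x = (t `^ (- a^-1))%:E]} -> 0 < a ->
  ((\int[mu]_(x in Q) `|h x|%:E) `^ r <=
     (\int[mu]_(x in Q) ((`|h x| `^ r)%:E * v x)) *
     (\int[mu]_(x in Q) (w x `^ s)) `^ (r - 1))%E.
Proof.
move=> mQ mh mv mw v0 w0 r1 sE vw a0.
have r0 : 0 < r by lra.
have r10 : 0 < r - 1 by lra.
have s0 : 0 < s by rewrite sE divr_gt0.
(* The inequality is applied to real functions on the whole space, so v and w are replaced by their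
   finite parts and the factors extended by 0. The finite parts are at most v and w, which is the
   direction wanted on the right-hand side. *)
pose f1 := (fun x => `|h x| * fine (v x) `^ r^-1) \_ Q.
pose g1 := (fun x => fine (w x) `^ (a / r)) \_ Q.
pose r' := r / (r - 1).
have r'0 : 0 < r' by rewrite divr_gt0.
have mhn : measurable_fun Q (fun x => `|h x|) by exact: measurableT_comp.
have mfine (z : T -> \bar R) : measurable_fun Q z -> measurable_fun Q (fun x => fine (z x)).
  by move=> mz; apply: measurableT_comp mz; exact: fine_measurable.
have mpow (z : T -> R) e : measurable_fun Q z -> measurable_fun Q (fun x => z x `^ e).
  by move=> mz; apply: (measurableT_comp (measurable_powR e)).
have mf : measurable_fun Q (fun x => `|h x| * fine (v x) `^ r^-1).
  by apply: measurable_funM => //; apply: mpow; exact: mfine.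
have mg : measurable_fun Q (fun x => fine (w x) `^ (a / r)).
  by apply: mpow; exact: mfine.
have mf1 : measurable_fun [set: T] f1 by apply/(measurable_restrictT _ mQ).
have mg1 : measurable_fun [set: T] g1 by apply/(measurable_restrictT _ mQ).
have conj : r^-1 + r'^-1 = 1 by rewrite /r'; field; rewrite ?(gt_eqF r0) ?(gt_eqF r10) ?(gt_eqF a0).
have := hoelder mu mf1 mg1 r0 r'0 conj.
have N1 : ('N[mu]_1 [EFin \o (f1 \* g1)%R] = \int[mu]_(x in Q) `|h x|%:E)%E.
  rewrite Lnorm1 [RHS]integral_mkcond.
  rewrite (_ : (fun x => _) = (fun x =>
      (`|h x| * fine (v x) `^ r^-1 * fine (w x) `^ (a / r))%:E) \_ Q); last first.
    apply/funext => x; rewrite /= /f1 /g1 !patchE; case: ifPn => _; last by rewrite mul0r normr0.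
    by rewrite ger0_norm// !mulr_ge0 ?powR_ge0.
  rewrite -!integral_mkcond; apply: ge0_ae_eq_integral => //.
  - by apply/measurable_EFinP; exact: measurable_funM.
  - by apply/measurable_EFinP.
  - by move=> x _; rewrite lee_fin !mulr_ge0 ?powR_ge0.
  - case: vw => N [mN N0 subN]; exists N; split => // x /= hx; apply: subN => /= h'.
    apply: hx => Qx; have [t [t0 -> ->]] := h' Qx.
    rewrite /= -powRrM -mulrA -powRD; last by rewrite (gt_eqF t0) implybT.
    rewrite (_ : _ + _ = 0); first by rewrite powRr0 mulr1.
    by field; rewrite ?(gt_eqF r0) ?(gt_eqF r10) ?(gt_eqF a0).
rewrite N1 => /(@poweR_le _ r _ _ (ltW r0)) H.
apply: (le_trans (H _)); first by apply: integral_ge0 => x _; rewrite lee_fin.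
rewrite poweRM ?Lnorm_ge0//; apply: lee_pmul; rewrite ?poweR_ge0//.
  rewrite poweR_Lnorm ?gt_eqF// [leRHS]integral_mkcond.
  rewrite -[leRHS]integral_mkcond.
  rewrite (_ : (fun x => _) = (fun x =>
      ((`|h x| `^ r) * fine (v x))%:E) \_ Q); last first.
    apply/funext => x; rewrite /= /f1 !patchE; case: ifPn => xQ; last first.
      by rewrite normr0 powR0// gt_eqF.
    rewrite inE in xQ; rewrite ger0_norm ?mulr_ge0 ?powR_ge0// powRM ?powR_ge0//.
    by rewrite -powRrM mulVf ?gt_eqF// powRr1// fine_ge0// v0.
  rewrite -integral_mkcond; apply: ge0_le_integral => //.
  - by move=> x Qx; rewrite lee_fin mulr_ge0 ?powR_ge0// fine_ge0// v0.
  - by apply/measurable_EFinP; apply: measurable_funM; [exact: mpow|exact: mfine].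
  - by apply: emeasurable_funM => //; apply/measurable_EFinP; exact: mpow.
  - move=> x Qx; rewrite EFinM lee_wpmul2l ?lee_fin ?powR_ge0//.
    by have := v0 x Qx; case: (v x) => //= _; rewrite leey.
rewrite [X in (_ `^ X <= _)%E](_ : r = r' * (r - 1)); last by rewrite /r' divfK// gt_eqF.
rewrite poweRrM poweR_Lnorm ?gt_eqF//; apply: poweR_le.
- exact: ltW.
- by apply: integral_ge0 => x _; exact: poweR_ge0.
rewrite (_ : (fun x => _) = (fun x => (fine (w x) `^ s)%:E) \_ Q); last first.
  apply/funext => x; rewrite /= /g1 !patchE; case: ifPn => xQ; last first.
    by rewrite normr0 powR0// gt_eqF.
  rewrite ger0_norm ?powR_ge0// -powRrM sE; congr ((_ `^ _)%:E).
  by rewrite /r'; field; rewrite ?(gt_eqF r0) ?(gt_eqF r10) ?(gt_eqF a0).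
rewrite -integral_mkcond; apply: ge0_le_integral => //.
- by move=> x Qx; rewrite lee_fin powR_ge0.
- by apply/measurable_EFinP; apply: mpow; exact: mfine.
- by apply: (measurableT_comp (measurable_poweR _)).
- move=> x Qx; have := w0 x Qx; case: (w x) => //= _.
  by rewrite gt_eqF// leey.
Qed.

(** * Weights on local cubes *)

Lemma local_cube_sub (R : realType) (n : nat) (Omega : set 'rV[R]_n.+1) (beta : R)
    (x : 'rV[R]_n.+1) (l : R) :
  0 < beta -> beta < 1 -> local_radii Omega beta x l -> cube x l `<=` Omega.
Proof.
move=> b0 b1 [l0 ld]; apply: cube_sub_Omega; apply: (lt_trans ld).
have d0 : 0 < dist_to x (~` Omega) by rewrite -(pmulr_rgt0 _ b0) (lt_trans l0).
by rewrite gtr_pMl.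
Qed.

Lemma cube_vol_gt0 (R : realType) (n : nat) (l : R) : 0 < l -> 0 < (2 * l) ^+ n.+1.
Proof. by move=> l0; rewrite exprn_gt0// mulr_gt0. Qed.

Lemma weight_on (R : realType) (n : nat) (Omega A : set 'rV[R]_n.+1)
    (w : 'rV[R]_n.+1 -> \bar R) :
  open Omega -> is_weight Omega w -> measurable (A : set (lebesgue_space R n)) ->
  A `<=` Omega ->
  measurable_fun (A : set (lebesgue_space R n)) (w : lebesgue_space R n -> \bar R) /\
  (forall x, A x -> (0 <= w x)%E).
Proof.
move=> oO [mw w0 _] mA AO; split; last by move=> x /AO; exact: w0.
by apply: measurable_funS mw => //; exact: measurable_open_rV.
Qed.

Lemma weight_mass_fin (R : realType) (n : nat) (Omega : set 'rV[R]_n.+1)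
    (w : 'rV[R]_n.+1 -> \bar R) (x : 'rV[R]_n.+1) (l : R) :
  is_weight Omega w -> cube x l `<=` Omega ->
  exists2 W : R, 0 <= W & weight_mass w (cube x l) = W%:E.
Proof.
move=> [mw w0 wK] QO.
have wfin := wK _ QO (@compact_cube R n x l).
have wge0 : (0 <= weight_mass w (cube x l))%E.
  by apply: integral_ge0 => y /QO; exact: w0.
exists (fine (weight_mass w (cube x l))); first exact: fine_ge0.
by rewrite fineK// ge0_fin_numE.
Qed.

Lemma weight_massS (R : realType) (n : nat) (Omega A B : set 'rV[R]_n.+1)
    (w : 'rV[R]_n.+1 -> \bar R) :
  open Omega -> is_weight Omega w -> measurable (A : set (lebesgue_space R n)) ->
  measurable (B : set (lebesgue_space R n)) -> A `<=` B -> B `<=` Omega ->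
  (weight_mass w A <= weight_mass w B)%E.
Proof.
move=> oO ww mA mB AB BO; have [mw w0] := weight_on oO ww mB BO.
exact: ge0_subset_integral.
Qed.

(** Clears the quotients of [A_infty]. On a cube of zero mass the quotient inequality says nothing,
    and monotonicity of the mass gives the bound instead. *)
Lemma A_infty_real (R : realType) (n : nat) (Omega : set 'rV[R]_n.+1) (beta : R)
    (w : 'rV[R]_n.+1 -> \bar R) :
  open Omega -> 0 < beta -> beta < 1 -> A_infty Omega beta w ->
  exists c delta : R, [/\ 0 < c, 0 < delta &
    forall x l W, Omega x -> local_radii Omega beta x l ->
      weight_mass w (cube x l) = W%:E ->
    forall E e, measurable (E : set (lebesgue_space R n)) -> E `<=` cube x l ->
      0 <= e -> (lebesgue E <= (e * (2 * l) ^+ n.+1)%:E)%E ->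
      (weight_mass w E <= (c * e `^ delta * W)%:E)%E].
Proof.
move=> oO b0 b1 [ww [c [delta [c0 d0 H]]]]; exists c, delta; split => // x l W Ox lx QW E e mE EQ e0 Ee.
have QO := local_cube_sub b0 b1 lx.
have l0 : 0 < l by case: lx.
have mQ := @measurable_cube R n x l.
have EleQ := weight_massS oO ww mE mQ EQ QO.
have W0 : 0 <= W by have [W' W'0] := weight_mass_fin ww QO; rewrite QW => -[->].
have [W00|Wn0] := eqVneq W 0.
  by rewrite W00 mulr0 (le_trans EleQ)// QW W00.
have {Wn0} W0' : 0 < W by rewrite lt_neqAle eq_sym Wn0.
have V0 := cube_vol_gt0 n l0.
have := H (cube x l) E; rewrite QW (lebesgue_cube x (ltW l0)) !inver (gt_eqF V0) (gt_eqF W0').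
move=> /(_ (ex_intro _ x (ex_intro _ l (And3 Ox lx erefl))) mE EQ).
rewrite lee_pdivrMr// => /le_trans; apply.
rewrite EFinM lee_wpmul2r ?lee_fin// EFinM lee_wpmul2l ?lee_fin ?(ltW c0)//.
rewrite -poweR_EFin; apply: poweR_le; first exact: ltW.
  by rewrite mule_ge0 ?lee_fin ?invr_ge0 ?(ltW V0).
by rewrite lee_pdivrMr// -EFinM.
Qed.

Lemma reverse_hoelder_A_infty (R : realType) (n : nat) (Omega : set 'rV[R]_n.+1)
    (beta : R) (w : 'rV[R]_n.+1 -> \bar R) :
  open Omega -> 0 < beta -> beta < 1 -> A_infty Omega beta w ->
  exists s C : R, [/\ 1 < s, 0 <= C &
    forall x l W, Omega x -> local_radii Omega beta x l ->
      weight_mass w (cube x l) = W%:E ->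
    (\int[@lebesgue R n]_(y in cube x l) w y `^ s <=
      (C * (2 * l) ^+ n.+1 * (W / (2 * l) ^+ n.+1) `^ s)%:E)%E].
Proof.
move=> oO b0 b1 Aw; have [c [delta [c0 d0 H]]] := A_infty_real oO b0 b1 Aw.
(* One half of [delta] pays for the growth of the levels, the other half for their summation. *)
case: Aw => ww _; pose eta := delta / 2; have eta0 : 0 < eta by rewrite divr_gt0.
exists (1 + eta), (1 + c * 2 `^ eta / (1 - 2 `^ (- eta))).
split; first by rewrite ltrDl.
  rewrite addr_ge0// divr_ge0 ?mulr_ge0 ?powR_ge0 ?(ltW c0)// subr_ge0.
  rewrite powRN invf_le1 ?powR_gt0//.
  rewrite [leLHS](_ : _ = 1 `^ eta); last by rewrite powR1.
  by apply: powR_le; lra.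
move=> x l W Ox lx QW.
have QO := local_cube_sub b0 b1 lx.
have l0 : 0 < l by case: lx.
have mQ := @measurable_cube R n x l.
have [mw w0] := weight_on oO ww mQ QO.
have [W' W'0] := weight_mass_fin ww QO; rewrite QW => -[WE]; rewrite -WE in W'0.
apply: (@reverse_hoelder _ _ _ (@lebesgue R n) (cube x l) w _ W c eta) => //.
- exact: cube_vol_gt0.
- exact: ltW.
- exact: (lebesgue_cube x (ltW l0)).
- move=> E e mE EQ e0 Ee.
  rewrite (_ : 2 * eta = delta); first exact: (H x l W).
  by rewrite /eta mulrC divfK// pnatr_eq0.
Qed.

Lemma A_pqP (R : realType) (n : nat) (Omega : set 'rV[R]_n.+1)
    (beta p q : R) (u v : 'rV[R]_n.+1 -> \bar R) :
  open Omega -> 0 < beta -> beta < 1 ->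
  is_weight Omega u -> is_weight Omega (dual_weight p v) ->
  A_pq Omega beta p q u v <->
  exists2 C : R, 0 <= C & forall x l U W, Omega x -> local_radii Omega beta x l ->
    weight_mass u (cube x l) = U%:E ->
    weight_mass (dual_weight p v) (cube x l) = W%:E ->
    U `^ (p / q) / (2 * l) ^+ n.+1 * (W / (2 * l) ^+ n.+1) `^ (p - 1) <= C.
Proof.
move=> oO b0 b1 wu ws; split=> [[C HC]|[C C0 HC]].
  exists (Num.max 0 C); first by rewrite le_max lexx.
  move=> x l U W Ox lx QU QW; rewrite le_max; apply/orP; right.
  have l0 : 0 < l by case: lx.
  have := HC (cube x l) (ex_intro _ x (ex_intro _ l (And3 Ox lx erefl))).
  by rewrite QU QW (lebesgue_cube x (ltW l0)) inver (gt_eqF (cube_vol_gt0 n l0)).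
exists C => _ [x [l [Ox lx ->]]]; have QO := local_cube_sub b0 b1 lx.
have l0 : 0 < l by case: lx.
have [U U0 QU] := weight_mass_fin wu QO; have [W W0 QW] := weight_mass_fin ws QO.
have := HC x l U W Ox lx QU QW.
by rewrite QU QW (lebesgue_cube x (ltW l0)) inver (gt_eqF (cube_vol_gt0 n l0)).
Qed.

(** Both v and its dual weight are integrable on the compact set A, hence finite almost everywhere
    there, which forces 0 < v < +oo. *)
Lemma dual_weight_ae (R : realType) (n : nat) (Omega A : set 'rV[R]_n.+1)
    (p : R) (v : 'rV[R]_n.+1 -> \bar R) :
  open Omega -> 1 < p -> is_weight Omega v -> is_weight Omega (dual_weight p v) ->
  measurable (A : set (lebesgue_space R n)) -> A `<=` Omega -> compact A ->
  {ae @lebesgue R n, forall x, A x -> exists t : R,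
    [/\ 0 < t, v x = t%:E & dual_weight p v x = (t `^ (- (p - 1)^-1))%:E]}.
Proof.
move=> oO p1 vw sw mA AO cA.
have [mv v0] := weight_on oO vw mA AO; have [ms s0] := weight_on oO sw mA AO.
case: vw => _ _ /(_ A AO cA) vfin; case: sw => _ _ /(_ A AO cA) sfin.
have := ge0_integral_fin_ae mA mv v0 vfin; have := ge0_integral_fin_ae mA ms s0 sfin.
apply: filterS2 => x h1 h2 Ax; apply: dual_weight_gt0 => //.
- exact: v0.
- exact: h2.
- exact: h1.
Qed.

(* Self-improvement of the exponent: the reverse Hoelder inequality for the dual
   weight lets Hoelder's inequality start from an exponent r < p. *)
Lemma A_pq_open (R : realType) (n : nat) (Omega : set 'rV[R]_n.+1)
    (beta p q : R) (u v : 'rV[R]_n.+1 -> \bar R) :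
  open Omega -> 0 < beta -> beta < 1 -> 1 < p ->
  is_weight Omega u -> is_weight Omega v ->
  A_infty Omega beta (dual_weight p v) -> A_pq Omega beta p q u v ->
  exists r K : R, [/\ 1 < r, r < p, 0 <= K &
    forall x l (h : 'rV[R]_n.+1 -> R) t, Omega x -> local_radii Omega beta x l ->
    measurable_fun (Omega : set (lebesgue_space R n)) (h : lebesgue_space R n -> R) ->
    0 < t ->
    (t%:E * lebesgue (cube x l) <= \int[@lebesgue R n]_(y in cube x l) `|h y|%:E)%E ->
    (weight_mass u (cube x l) `^ (p / q) * (t `^ r)%:E <=
      K%:E * \int[@lebesgue R n]_(y in cube x l) ((`|h y| `^ r)%:E * v y))%E].
Proof.
move=> oO b0 b1 p1 wu wv As Apq.
have [s [C [s1 C0 RH]]] := reverse_hoelder_A_infty oO b0 b1 As.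
have ws : is_weight Omega (dual_weight p v) by case: As.
have [D D0 HD] := (A_pqP q oO b0 b1 wu ws).1 Apq.
have p10 : 0 < p - 1 by rewrite subr_gt0.
have s0 : 0 < s by lra.
(* Chosen so that the exponent (p - 1) / (r - 1), which Hoelder's inequality puts on the dual
   weight, is the s of the reverse Hoelder inequality; s > 1 gives r < p. *)
pose r := 1 + (p - 1) / s.
have r1 : 1 < r by rewrite ltrDl divr_gt0.
have r0 : 0 < r by lra.
have rp : r < p.
  by rewrite -ltrBrDl ltr_pdivrMr// ltr_pMr.
exists r, (C `^ (r - 1) * D); split => //; first by rewrite mulr_ge0 ?powR_ge0.
move=> x l h t Ox lx mh t0.
have QO := local_cube_sub b0 b1 lx.
have l0 : 0 < l by case: lx.
have mQ := @measurable_cube R n x l.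
have [mv v0] := weight_on oO wv mQ QO; have [ms sg0] := weight_on oO ws mQ QO.
have [U U0 QU] := weight_mass_fin wu QO; have [W W0 QW] := weight_mass_fin ws QO.
have mhQ : measurable_fun (cube x l : set (lebesgue_space R n)) (h : lebesgue_space R n -> R).
  by apply: measurable_funS mh => //; exact: measurable_open_rV.
rewrite (lebesgue_cube x (ltW l0)) QU poweR_EFin.
set V := (2 * l) ^+ n.+1; have V0 : 0 < V by exact: cube_vol_gt0.
have sE : s = (p - 1) * (r - 1)^-1.
  by rewrite /r addrAC subrr add0r invf_div mulrC divfK// gt_eqF.
have hold := @weighted_hoelder _ _ _ (@lebesgue R n) (cube x l) h v (dual_weight p v)
  (p - 1) r s mQ mhQ mv ms v0 sg0 r1 sE
  (dual_weight_ae oO p1 wv ws mQ QO (@compact_cube R n x l)) p10.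
move: hold; set I := (\int[@lebesgue R n]_(y in cube x l) ((`|h y| `^ r)%:E * v y))%E => hold tV.
have I0 : (0 <= I)%E.
  by apply: integral_ge0 => y /v0 vy; rewrite mule_ge0// lee_fin powR_ge0.
have {RH} RH := RH x l W Ox lx QW; rewrite -/V in RH.
pose b := (C * V * (W / V) `^ s) `^ (r - 1).
have Ht : (((t * V) `^ r)%:E <= I * b%:E)%E.
  apply: (@le_trans _ _ ((\int[@lebesgue R n]_(y in cube x l) `|h y|%:E) `^ r)%E).
    rewrite -poweR_EFin; apply: poweR_le; first exact: ltW.
    - by rewrite lee_fin mulr_ge0// ltW.
    - by rewrite EFinM.
  apply: (le_trans hold); rewrite lee_wpmul2l// /b -poweR_EFin; apply: poweR_le => //.
  - by rewrite subr_ge0 ltW.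
  - by apply: integral_ge0 => y _; exact: poweR_ge0.
have WV0 : 0 <= W / V by rewrite divr_ge0 ?(ltW V0).
(* As s (r - 1) = p - 1, the mean of the dual weight appears to the very power that A_pq
   controls. *)
have bE : b = C `^ (r - 1) * V `^ (r - 1) * (W / V) `^ (p - 1).
  rewrite /b powRM ?mulr_ge0 ?powR_ge0 ?(ltW V0)// powRM ?(ltW V0)// -powRrM sE divfK//.
  by rewrite gt_eqF// subr_gt0.
have Vr : V `^ r = V * V `^ (r - 1).
  by rewrite -{2}(powRr1 (ltW V0)) -powRD ?(gt_eqF V0) ?implybT//; congr (_ `^ _); ring.
have Vr0 : 0 < V `^ r by rewrite powR_gt0.
have := HD x l U W Ox lx QU QW; rewrite -/V => HDx.
apply: (@le_trans _ _ ((U `^ (p / q) / V `^ r)%:E * (I * b%:E))%E).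
  rewrite -EFinM (_ : _ * t `^ r = U `^ (p / q) / V `^ r * (t * V) `^ r).
    by rewrite EFinM lee_wpmul2l// lee_fin divr_ge0 ?powR_ge0.
  by rewrite powRM ?(ltW t0) ?(ltW V0)//; field; rewrite gt_eqF.
rewrite muleCA -EFinM muleC lee_wpmul2r// lee_fin bE Vr.
rewrite [leLHS](_ : _ = C `^ (r - 1) * (U `^ (p / q) / V * (W / V) `^ (p - 1))).
  by rewrite ler_wpM2l ?powR_ge0.
by field; rewrite (gt_eqF V0) gt_eqF// powR_gt0.
Qed.

(** * Weak type inequality *)

(** Superadditivity: x^theta is x times the nondecreasing factor x^(theta - 1). Applied with theta =
    q / p, both to the selected cubes and to the dyadic levels. *)
Lemma sum_poweR_le (R : realType) (I : Type) (s : seq I) (a : I -> \bar R) (theta : R) :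
  1 <= theta -> (forall i, (0 <= a i)%E) ->
  (\sum_(i <- s) a i `^ theta <= (\sum_(i <- s) a i) `^ theta)%E.
Proof.
move=> th1 a0; elim: s => [|i s IHs]; first by rewrite !big_nil poweR_ge0.
rewrite !big_cons; set S := (\sum_(j <- s) a j)%E in IHs *.
have S0 : (0 <= S)%E by exact: sume_ge0.
have split_th (x : \bar R) : (0 <= x)%E -> (x `^ theta = x * x `^ (theta - 1))%E.
  by move=> x0; rewrite -poweRS ?subr_ge0//; congr (_ `^ _)%E; ring.
apply: (@le_trans _ _ (a i `^ theta + S `^ theta)%E); first by rewrite leeD2l.
rewrite [leRHS]split_th ?adde_ge0// ge0_muleDl//.
by apply: leeD; rewrite split_th// lee_wpmul2l//; apply: poweR_le; rewrite ?subr_ge0//;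
  rewrite ?leeDl ?leeDr.
Qed.

Lemma sum_integral_patch d (T : measurableType d) (R : realType)
    (mu : {measure set T -> \bar R}) (I : Type) (s : seq I) (D : set T)
    (Q : I -> set T) (g : T -> \bar R) :
  measurable D -> (forall i, measurable (Q i)) -> measurable_fun D g ->
  (forall x, D x -> 0 <= g x)%E ->
  (\sum_(i <- s) \int[mu]_(x in D `&` Q i) g x =
   \int[mu]_(x in D) \sum_(i <- s) (g \_ (Q i)) x)%E.
Proof.
move=> mD mQ mg g0; rewrite ge0_integral_sum//.
- by apply: eq_bigr => i _; rewrite integral_mkcondr.
- move=> i; apply/(measurable_restrict _ (mQ i) mD); apply: measurable_funS mg => //.
- by move=> i x Dx; rewrite patchE; case: ifP => // _; exact: g0.
Qed.

Lemma sum_patch_count (R : realType) (T I : Type) (s : seq I) (Q : I -> set T)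
    (P : T -> pred I) (g : T -> \bar R) (x : T) :
  (forall i, (x \in Q i) = P x i) -> (0 <= g x)%E ->
  (\sum_(i <- s) (g \_ (Q i)) x = (count (P x) s)%:R%:E * g x)%E.
Proof.
move=> QP g0; elim: s => [|i s IHs]; first by rewrite big_nil mul0e.
rewrite big_cons IHs patchE QP /=; case: (P x i); rewrite /= ?add0e//.
by rewrite natrD EFinD ge0_muleDl ?lee_fin// mul1e.
Qed.

Lemma sum_integral_overlap (R : realType) (n : nat) (Omega : set 'rV[R]_n.+1)
    (g : 'rV[R]_n.+1 -> \bar R) (xs : seq 'rV[R]_n.+1) (l : 'rV[R]_n.+1 -> R) (M : nat) :
  measurable (Omega : set (lebesgue_space R n)) ->
  measurable_fun (Omega : set (lebesgue_space R n)) (g : lebesgue_space R n -> \bar R) ->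
  (forall x, Omega x -> (0 <= g x)%E) ->
  (forall y, count (fun x => (`|x - y| <= l x)%R) xs <= M)%N ->
  (\sum_(x <- xs) \int[@lebesgue R n]_(y in Omega `&` cube x (l x)) g y <=
    M%:R%:E * \int[@lebesgue R n]_(y in Omega) g y)%E.
Proof.
move=> mO mg g0 ov.
rewrite (@sum_integral_patch _ (lebesgue_space R n) R (@lebesgue R n) _ xs Omega
  (fun x => cube x (l x)) g)//; last by move=> x; exact: measurable_cube.
rewrite -ge0_integralZl//.
have E y : Omega y -> (\sum_(x <- xs) (g \_ (cube x (l x))) y =
    (count (fun x => (`|x - y| <= l x)%R) xs)%:R%:E * g y)%E.
  move=> Oy; apply: (@sum_patch_count R _ _ xs _ (fun y x => (`|x - y| <= l x))).
    move=> x; apply/idP/idP; first by rewrite inE.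
    by move=> h; rewrite inE.
  exact: g0.
apply: ge0_le_integral; first exact: mO.
- by move=> y Oy; rewrite E// mule_ge0 ?lee_fin// g0.
- apply: emeasurable_sum => x; apply/measurable_restrict => //.
    exact: measurable_cube.
  by apply: measurable_funS mg => //.
- exact: measurable_funeM.
- by move=> y Oy; rewrite E// lee_wpmul2r ?g0// lee_fin ler_nat.
Qed.

Lemma integral_cover_le (R : realType) (n : nat) (Omega A : set 'rV[R]_n.+1)
    (g : 'rV[R]_n.+1 -> \bar R) (xs : seq 'rV[R]_n.+1) (l : 'rV[R]_n.+1 -> R) :
  measurable (Omega : set (lebesgue_space R n)) ->
  measurable_fun (Omega : set (lebesgue_space R n)) (g : lebesgue_space R n -> \bar R) ->
  (forall x, Omega x -> (0 <= g x)%E) ->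
  measurable (A : set (lebesgue_space R n)) -> A `<=` Omega ->
  (forall y, A y -> exists2 x, x \in xs & cube x (l x) y) ->
  (\int[@lebesgue R n]_(y in A) g y <=
   \sum_(x <- xs) \int[@lebesgue R n]_(y in Omega `&` cube x (l x)) g y)%E.
Proof.
move=> mO mg g0 mA AO cov.
rewrite (@sum_integral_patch _ (lebesgue_space R n) R (@lebesgue R n) _ xs Omega
  (fun x => cube x (l x)) g)//; last by move=> x; exact: measurable_cube.
have mpatch x : measurable_fun (Omega : set (lebesgue_space R n))
    (g \_ (cube x (l x)) : lebesgue_space R n -> \bar R).
  apply/measurable_restrict => //; first exact: measurable_cube.
  exact: measurable_funS mg.
have patch0 x y : Omega y -> (0 <= (g \_ (cube x (l x))) y)%E.
  by move=> Oy; rewrite patchE; case: ifP => // _; exact: g0.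
apply: (@le_trans _ _
    (\int[@lebesgue R n]_(y in A) \sum_(x <- xs) (g \_ (cube x (l x))) y)%E).
  apply: ge0_le_integral; first exact: mA.
  - by move=> y /AO; exact: g0.
  - exact: measurable_funS mg.
  - by apply: emeasurable_sum => x; exact: measurable_funS (mpatch x).
  - move=> y Ay; have [x xxs xy] := cov y Ay; have Oy := AO _ Ay.
    rewrite (big_rem x)//= patchE mem_set// leeDl//.
    by apply: sume_ge0 => z _; exact: patch0.
apply: ge0_subset_integral; [exact: mA|exact: mO| | |exact: AO].
- by apply: emeasurable_sum => x; exact: mpatch.
- by move=> y Oy; apply: sume_ge0 => x _; exact: patch0.
Qed.

Definition level_at (R : realType) (n : nat) (Omega : set 'rV[R]_n.+1) (beta : R)
    (h : 'rV[R]_n.+1 -> R) (t : R) (x : 'rV[R]_n.+1) (l : R) : Prop :=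
  [/\ Omega x, local_radii Omega beta x l &
    (t%:E * lebesgue (cube x l) < \int[@lebesgue R n]_(y in cube x l) `|h y|%:E)%E].

(** This is {M h > t} inside Omega ([maximal_gtE]), written with witnesses because the covering
    argument works with the radius attached to each point. *)
Definition level_set (R : realType) (n : nat) (Omega : set 'rV[R]_n.+1) (beta : R)
    (h : 'rV[R]_n.+1 -> R) (t : R) : set 'rV[R]_n.+1 :=
  [set x | exists l, level_at Omega beta h t x l].

(** Both strict inequalities survive a slight enlargement of the cube, by continuity of the volume.
    The room gained allows the center to move. *)
Lemma radius_slack (R : realType) (N : nat) (t l B : R) (a : \bar R) :
  ((t * (2 * l) ^+ N)%:E < a)%E -> l < B ->
  exists l', [/\ l < l', l' < B & ((t * (2 * l') ^+ N)%:E < a)%E].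
Proof.
move=> la lB.
have cf : (fun y : R => t * (2 * y) ^+ N) @ l --> t * (2 * l) ^+ N.
  apply: cvgM; first exact: cvg_cst.
  apply: (@continuous_comp _ _ _ (fun y : R => 2 * y) (fun y => y ^+ N)).
    by apply: cvgM; [exact: cvg_cst|exact: cvg_id].
  exact: exprn_continuous.
have Ha : \forall y \near l^'+, ((t * (2 * y) ^+ N)%:E < a)%E.
  case: a la => [a| |]// la; last by near=> y; rewrite ltry.
  have cfa : \forall y \near l, t * (2 * y) ^+ N < a by exact: (cvgr_lt _ cf).
  by apply: filterS cfa => y ya _.
have : \forall y \near l^'+, [/\ l < y, y < B & ((t * (2 * y) ^+ N)%:E < a)%E].
  near=> y; split.
  - by near: y; exact: nbhs_right_gt.
  - by near: y; exact: nbhs_right_lt.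
  - by near: y; exact: Ha.
by move=> /filter_ex.
Unshelve. all: by end_near. Qed.

(** If Q(x, l) witnesses the level t, then so does Q(z, l') for every z near x and one l' slightly
    above l, since Q(z, l') contains Q(x, l) and the strict inequality has slack. The radius is thus
    locally constant, which gives measurability and, after truncation, finitely many radii. *)
Lemma level_cover (R : realType) (n : nat) (Omega : set 'rV[R]_n.+1) (beta : R)
    (h : 'rV[R]_n.+1 -> R) (t : R) :
  open Omega -> ~` Omega !=set0 -> 0 < beta -> beta < 1 ->
  measurable_fun (Omega : set (lebesgue_space R n)) (h : lebesgue_space R n -> R) ->
  0 <= t ->
  exists (c : nat -> 'rV[R]_n.+1) (r l : nat -> R),
    (forall i x, cube (c i) (r i) x -> level_at Omega beta h t x (l i)) /\
    level_set Omega beta h t `<=` \bigcup_i cube (c i) (r i).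
Proof.
move=> oO cO0 b0 b1 mh t0.
have [||c [r [H1 H2]]] := @lindelof R n (level_set Omega beta h t)
  (fun A => exists l, forall x, A x -> level_at Omega beta h t x l).
- by exists 0.
- move=> x [l [Ox [l0 ld]]]; rewrite (lebesgue_cube x (ltW l0)) -EFinM => la.
  have [l' [ll' l'd l'a]] := radius_slack la ld.
  (* The first bound yields Q(x, l) inside Q(z, l'). The second keeps l' < beta d(z, Omega^c), as
     the distance is 1-Lipschitz. *)
  pose rho := Num.min (l' - l) ((beta * dist_to x (~` Omega) - l') / (2 * beta)).
  have rho0 : 0 < rho by rewrite lt_min subr_gt0 ll' divr_gt0 ?subr_gt0 ?mulr_gt0.
  exists rho => // y s ys; exists l' => z /ys xz.
  have xz1 : `|x - z| <= l' - l.
    by apply: le_trans xz _; rewrite ge_min lexx.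
  have xz2 : beta * `|x - z| < beta * dist_to x (~` Omega) - l'.
    apply: (@le_lt_trans _ _ (beta * ((beta * dist_to x (~` Omega) - l') / (2 * beta)))).
      by rewrite ler_pM2l//; apply: le_trans xz _; rewrite ge_min lexx orbT.
    rewrite (_ : _ * (_ / _) = (beta * dist_to x (~` Omega) - l') / 2); first lra.
    by field; rewrite gt_eqF.
  have l'0 : 0 < l' by exact: lt_trans ll'.
  have rz : local_radii Omega beta z l'.
    split => //; have := dist_to_lip x z cO0.
    by rewrite -(ler_pM2l b0) mulrDr; lra.
  have QO := local_cube_sub b0 b1 rz.
  split => //; first by apply: QO; apply: cube_center; exact: ltW.
  rewrite (lebesgue_cube z (ltW l'0)) -EFinM; apply: (lt_le_trans l'a).
  have sub : cube x l `<=` cube z l'.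
    by apply: cube_sub; rewrite distrC -lerBrDr.
  apply: ge0_subset_integral; [exact: measurable_cube|exact: measurable_cube| | |exact: sub].
  - have mhn : measurable_fun (Omega : set (lebesgue_space R n))
        ((fun y => `|h y|) : lebesgue_space R n -> R) by exact: measurableT_comp.
    apply/measurable_EFinP; apply: measurable_funS mhn; last exact: QO.
    exact: measurable_open_rV.
  - by move=> z1 _; rewrite lee_fin.
- have [l hl] := choice H1.
  by exists c, r, l; split => // i x; exact: hl.
Qed.

(** Finitely many covering cubes form a bounded set with at most [N] radii, as the greedy selection
    requires; each point takes the radius of one covering cube that contains it. *)
Lemma level_besicovitch (R : realType) (n : nat) (Omega : set 'rV[R]_n.+1) (beta : R)
    (h : 'rV[R]_n.+1 -> R) (t : R) (c : nat -> 'rV[R]_n.+1) (r l : nat -> R) (N : nat) :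
  (forall i x, cube (c i) (r i) x -> level_at Omega beta h t x (l i)) ->
  exists (xs : seq 'rV[R]_n.+1) (el : 'rV[R]_n.+1 -> R),
    [/\ forall x, x \in xs -> level_at Omega beta h t x (el x),
        forall y, (count (fun x => (`|x - y| <= el x)%R) xs <= 2 ^ n.+1)%N &
        forall y, (\bigcup_(i < N) cube (c i) (r i)) y -> exists2 x, x \in xs & cube x (el x) y].
Proof.
move=> H; pose A := \bigcup_(i < N) cube (c i) (r i).
have /choice[k hk] : forall x, exists i, A x -> (i < N)%N /\ cube (c i) (r i) x.
  move=> x; have [[i iN xi]|nA] := pselect (A x); last by exists 0%N.
  by exists i.
pose M := \sum_(i < N) (`|c i| + `|r i|).
have AM : A `<=` cube 0 M.
  move=> x [i iN xi]; rewrite /cube /closed_ball_ /= sub0r normrN.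
  apply: (@le_trans _ _ (`|c i| + `|r i|)).
    rewrite -[x](subKr (c i)) (le_trans (ler_normB _ _))// lerD2l//.
    by rewrite (le_trans xi)// ler_norm.
  rewrite /M (bigD1 (Ordinal iN))//= lerDl; apply: sumr_ge0 => j _.
  exact: addr_ge0.
have M0 : 0 <= M by apply: sumr_ge0 => j _; exact: addr_ge0.
have [|xs [xsA xsr cov]] := @besicovitch_selection R n A (l \o k) [seq l i | i <- iota 0 N] M M0 AM.
  move=> x Ax; have [kN xk] := hk x Ax; split.
    by have [_ []] := H _ _ xk.
  by apply/mapP; exists (k x) => //; rewrite mem_iota.
exists xs, (l \o k); split => //.
  by move=> x /xsA Ax; apply: H; exact: (hk x Ax).2.
by move=> y; exact: besicovitch_overlap.
Qed.

Lemma weak_type (R : realType) (n : nat) (Omega : set 'rV[R]_n.+1)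
    (beta p q : R) (u v : 'rV[R]_n.+1 -> \bar R) :
  open Omega -> ~` Omega !=set0 -> 0 < beta -> beta < 1 -> 1 < p -> p <= q ->
  is_weight Omega u -> is_weight Omega v ->
  A_infty Omega beta (dual_weight p v) -> A_pq Omega beta p q u v ->
  exists r K : R, [/\ 1 < r, r < p, 0 <= K &
    forall (h : 'rV[R]_n.+1 -> R) t,
    measurable_fun (Omega : set (lebesgue_space R n)) (h : lebesgue_space R n -> R) ->
    0 < t ->
    measurable (level_set Omega beta h t : set (lebesgue_space R n)) /\
    (weight_mass u (level_set Omega beta h t) <=
      ((K * t `^ (- r))%:E *
       \int[@lebesgue R n]_(y in Omega) ((`|h y| `^ r)%:E * v y)) `^ (q / p))%E].
Proof.
move=> oO cO0 b0 b1 p1 pq wu wv As Apq.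
have [r [K [r1 rp K0 HK]]] := A_pq_open oO b0 b1 p1 wu wv As Apq.
have p0 : 0 < p by lra.
have q0 : 0 < q by lra.
have qp1 : 1 <= q / p by rewrite ler_pdivlMr// mul1r.
exists r, ((2 ^ n.+1)%:R * K); split => //; first by rewrite mulr_ge0.
move=> h t mh t0; have [c [rad [l [H1 H2]]]] := level_cover oO cO0 b0 b1 mh (ltW t0).
pose A N := \bigcup_(i < N) cube (c i) (rad i).
have mA N : measurable (A N : set (lebesgue_space R n)).
  by apply: bigcup_measurable => i _; exact: measurable_cube.
have GE : level_set Omega beta h t = \bigcup_N A N.
  apply/seteqP; split.
    by move=> x /H2[i _ xi]; exists i.+1 => //; exists i => //=.
  by move=> x [N _ [i _ /H1 xi]]; exists (l i).
have AO N : A N `<=` Omega by move=> x [i _ /H1[]].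
have mO := measurable_open_rV oO.
have [mu_ u0] := weight_on oO wu mO (@subset_refl _ Omega).
have [mv v0] := weight_on oO wv mO (@subset_refl _ Omega).
have ndA : nondecreasing_seq A.
  by move=> i j ij; apply/subsetPset => x [k /= ki xk]; exists k => //=; exact: leq_trans ij.
split; first by rewrite GE; apply: bigcup_measurable.
(* The estimate for the finite unions [A N] has a constant independent of N, so monotone convergence
   carries it over to the level set. *)
have cvA := @ge0_nondecreasing_set_cvg_integral _ (lebesgue_space R n) R A u (@lebesgue R n)
  ndA mA (fun N => measurable_funS mO (@AO N) mu_) (fun N x Ax => u0 x (AO N x Ax)).
rewrite /weight_mass GE; apply: (cvge_to_le cvA); apply: nearW => N.
have [xs [el [xsG ov cov]]] := level_besicovitch N H1.
apply: le_trans (integral_cover_le mO mu_ u0 (mA N) (@AO N) cov) _.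
pose g y := ((`|h y| `^ r)%:E * v y)%E.
have g0 y : Omega y -> (0 <= g y)%E by move=> Oy; rewrite mule_ge0 ?lee_fin ?powR_ge0 ?v0.
have mg : measurable_fun (Omega : set (lebesgue_space R n)) (g : lebesgue_space R n -> \bar R).
  apply: emeasurable_funM; last exact: mv.
  apply/measurable_EFinP; by apply: (measurableT_comp (measurable_powR r)); exact: measurableT_comp.
have Ktr : 0 <= K * t `^ (- r) by rewrite mulr_ge0 ?powR_ge0.
pose b x := ((K * t `^ (- r))%:E *
  \int[@lebesgue R n]_(y in Omega `&` cube x (el x)) g y)%E.
have b_ge0 x : (0 <= b x)%E.
  by rewrite mule_ge0 ?lee_fin//; apply: integral_ge0 => y [/g0].
apply: (@le_trans _ _ (\sum_(x <- xs) b x `^ (q / p))%E).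
  rewrite big_seq [leRHS]big_seq; apply: lee_sum => x xxs.
  have [Ox lx ha] := xsG x xxs.
  have QO := local_cube_sub b0 b1 lx.
  rewrite /b setIidr//.
  have [U U0 QU] := weight_mass_fin wu QO.
  have := HK x (el x) h t Ox lx mh t0 (ltW ha).
  rewrite QU poweR_EFin => HU.
  apply: (@le_trans _ _ (weight_mass u (cube x (el x)))); first exact: lexx.
  rewrite QU.
  (* The local estimate bounds u(Q)^(p/q); raising it to q / p leaves a sum of powers q / p over the
     selected cubes. *)
  rewrite (_ : U%:E = ((U `^ (p / q))%:E `^ (q / p))%E); last first.
    rewrite poweR_EFin -powRrM (_ : _ * _ = 1) ?powRr1//.
    by field; rewrite !gt_eqF.
  apply: poweR_le; rewrite ?lee_fin ?powR_ge0//; first by lra.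
  rewrite EFinM -muleA muleCA powRN.
  by rewrite lee_pdivlMl ?powR_gt0// muleC.
apply: (le_trans (sum_poweR_le _ _ _)) => //.
apply: poweR_le; first by lra.
  exact: sume_ge0.
rewrite -ge0_sume_distrr//; last by move=> x _; apply: integral_ge0 => y [/g0].
rewrite [leRHS](_ : _ = (K * t `^ (- r))%:E *
    ((2 ^ n.+1)%:R%:E * \int[@lebesgue R n]_(y in Omega) g y))%E; last first.
  by rewrite muleA -EFinM; congr (_%:E * _)%E; ring.
rewrite lee_wpmul2l ?lee_fin//; exact: sum_integral_overlap.
Qed.

(** * Strong type inequality *)

Lemma level_set_measurable (R : realType) (n : nat) (Omega : set 'rV[R]_n.+1) (beta : R)
    (h : 'rV[R]_n.+1 -> R) (t : R) :
  open Omega -> ~` Omega !=set0 -> 0 < beta -> beta < 1 ->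
  measurable_fun (Omega : set (lebesgue_space R n)) (h : lebesgue_space R n -> R) ->
  0 <= t -> measurable (level_set Omega beta h t : set (lebesgue_space R n)).
Proof.
move=> oO cO0 b0 b1 mh t0; have [c [r [l [H1 H2]]]] := level_cover oO cO0 b0 b1 mh t0.
rewrite (_ : level_set Omega beta h t = \bigcup_i cube (c i) (r i)).
  by apply: bigcup_measurable => i _; exact: measurable_cube.
by apply/seteqP; split => // x [i _ /H1 xi]; exists (l i).
Qed.

Lemma maximal_gtE (R : realType) (n : nat) (Omega : set 'rV[R]_n.+1) (beta : R)
    (f : 'rV[R]_n.+1 -> R) (t : R) :
  Omega `&` [set x | (t%:E < centered_local_maximal Omega beta f x)%E] =
  level_set Omega beta f t.
Proof.
have key x l : 0 < l -> (t%:E < (lebesgue (cube x l))^-1 *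
    \int[@lebesgue R n]_(y in cube x l) `|f y|%:E)%E <->
    (t%:E * lebesgue (cube x l) < \int[@lebesgue R n]_(y in cube x l) `|f y|%:E)%E.
  move=> l0; have V0 := cube_vol_gt0 n l0.
  by rewrite (lebesgue_cube x (ltW l0)) inver (gt_eqF V0) lte_pdivlMl// muleC.
apply/seteqP; split => x /=.
  move=> [Ox /ereal_sup_gt[_ [l lx <-]]]; have l0 : 0 < l by case: lx.
  by move/(key x l l0) => H; exists l.
move=> [l [Ox lx]]; have l0 : 0 < l by case: lx.
move/(key x l l0) => H; split => //; apply: (lt_le_trans H).
by apply: ereal_sup_ubound; exists l.
Qed.

(** At a point of Omega the distance to the complement is positive, so some cube is admissible; a
    supremum over no cube would be -oo. *)
Lemma maximal_ge0 (R : realType) (n : nat) (Omega : set 'rV[R]_n.+1) (beta : R)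
    (f : 'rV[R]_n.+1 -> R) (x : 'rV[R]_n.+1) :
  open Omega -> ~` Omega !=set0 -> 0 < beta -> Omega x ->
  (0 <= centered_local_maximal Omega beta f x)%E.
Proof.
move=> oO cO0 b0 Ox; have d0 := dist_to_gt0 oO cO0 Ox.
have l0 : 0 < beta * dist_to x (~` Omega) / 2 by rewrite divr_gt0// mulr_gt0.
apply: (@le_trans _ _ ((lebesgue (cube x (beta * dist_to x (~` Omega) / 2)))^-1 *
  \int[@lebesgue R n]_(y in cube x (beta * dist_to x (~` Omega) / 2)) `|f y|%:E)%E).
  rewrite mule_ge0//; last by apply: integral_ge0 => y _; rewrite lee_fin.
  by rewrite inve_ge0 (lebesgue_cube x (ltW l0)) lee_fin ltW// cube_vol_gt0.
apply: ereal_sup_ubound; exists (beta * dist_to x (~` Omega) / 2) => //; split => //.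
by rewrite ltr_pdivrMr// ltr_pMr ?mulr_gt0//; lra.
Qed.

Lemma maximal_measurable (R : realType) (n : nat) (Omega : set 'rV[R]_n.+1) (beta : R)
    (f : 'rV[R]_n.+1 -> R) :
  open Omega -> ~` Omega !=set0 -> 0 < beta -> beta < 1 ->
  measurable_fun (Omega : set (lebesgue_space R n)) (f : lebesgue_space R n -> R) ->
  measurable_fun (Omega : set (lebesgue_space R n))
    (centered_local_maximal Omega beta f : lebesgue_space R n -> \bar R).
Proof.
move=> oO cO0 b0 b1 mf; apply: (measurability _ (ErealGenOInfty.measurableE R)).
move=> /= _ [_ [t ->] <-]; rewrite preimage_itvoy.
have [t0|t0] := leP 0 t.
  by rewrite [X in measurable X]maximal_gtE; exact: level_set_measurable.
rewrite [X in measurable X](_ : _ = Omega); first exact: measurable_open_rV.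
apply/seteqP; split => [x []//|x Ox]; split => //=.
by apply: (@lt_le_trans _ _ 0%E); [rewrite lte_fin|exact: maximal_ge0].
Qed.

Definition truncate_above (R : realType) (n : nat) (Omega : set 'rV[R]_n.+1)
    (f : 'rV[R]_n.+1 -> R) (t : R) : 'rV[R]_n.+1 -> R :=
  f \_ (Omega `&` [set x | t < `|f x|]).

Lemma truncate_above_measurable (R : realType) (n : nat) (Omega : set 'rV[R]_n.+1)
    (f : 'rV[R]_n.+1 -> R) (t : R) : open Omega ->
  measurable_fun (Omega : set (lebesgue_space R n)) (f : lebesgue_space R n -> R) ->
  measurable_fun (Omega : set (lebesgue_space R n))
    (truncate_above Omega f t : lebesgue_space R n -> R).
Proof.
move=> oO mf; have mO := measurable_open_rV oO.
have mfn : measurable_fun (Omega : set (lebesgue_space R n))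
    ((fun x => `|f x|%:E) : lebesgue_space R n -> \bar R).
  by apply/measurable_EFinP; exact: measurableT_comp.
have mS : measurable (Omega `&` [set x | t < `|f x|] : set (lebesgue_space R n)).
  have := emeasurable_fun_o_infty mO mfn t%:E.
  by congr (measurable (_ `&` _)); apply/funext => x /=; rewrite lte_fin.
apply/(measurable_restrict _ mS mO); apply: measurable_funS mf => //.
Qed.

(** On Omega, |f| is at most t / 2 plus its truncation, so dropping the small values lowers a mean
    by at most t / 2. *)
Lemma level_set_truncate (R : realType) (n : nat) (Omega : set 'rV[R]_n.+1) (beta : R)
    (f : 'rV[R]_n.+1 -> R) (t : R) :
  open Omega -> 0 < beta -> beta < 1 ->
  measurable_fun (Omega : set (lebesgue_space R n)) (f : lebesgue_space R n -> R) ->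
  0 < t ->
  level_set Omega beta f t `<=`
    level_set Omega beta (truncate_above Omega f (t / 2)) (t / 2).
Proof.
move=> oO b0 b1 mf t0 x [l [Ox lx H]]; exists l; split => //.
have l0 : 0 < l by case: lx.
have QO := local_cube_sub b0 b1 lx.
have mQ := @measurable_cube R n x l; have mO := measurable_open_rV oO.
have mh := @truncate_above_measurable R n Omega f (t / 2) oO mf.
have V0 := cube_vol_gt0 n l0.
rewrite (lebesgue_cube x (ltW l0)) -!EFinM in H *.
set h := truncate_above _ _ _ in mh *; set I := (\int[_]_(y in _) _)%E.
suff : (\int[@lebesgue R n]_(y in cube x l) `|f y|%:E <= I + (t / 2 * (2 * l) ^+ n.+1)%:E)%E.
  move=> /(lt_le_trans H); case: I => [a| |]//; rewrite ?ltry//.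
  by rewrite -EFinD !lte_fin => ?; lra.
have mhn : measurable_fun (cube x l : set (lebesgue_space R n))
    ((fun y => `|h y|%:E) : lebesgue_space R n -> \bar R).
  apply/measurable_EFinP; apply: (measurable_funS mO QO); exact: measurableT_comp.
have mfn : measurable_fun (cube x l : set (lebesgue_space R n))
    ((fun y => `|f y|%:E) : lebesgue_space R n -> \bar R).
  apply/measurable_EFinP; apply: (measurable_funS mO QO); exact: measurableT_comp.
have -> : ((t / 2 * (2 * l) ^+ n.+1)%:E =
    \int[@lebesgue R n]_(y in cube x l) (cst (t / 2)%:E) y)%E.
  by rewrite integral_cst// EFinM; congr (_ * _)%E; rewrite -(lebesgue_cube x (ltW l0)).
rewrite /I -ge0_integralD//; last by move=> y _; rewrite lee_fin divr_ge0// ltW.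
apply: ge0_le_integral; first exact: mQ.
- by move=> y _; rewrite lee_fin.
- exact: mfn.
- by apply: emeasurable_funD.
- move=> y /QO Oy; rewrite /= -EFinD lee_fin /h /truncate_above patchE.
  case: ifPn => [_|]; first by rewrite lerDl divr_ge0// ltW.
  rewrite notin_setE /= => hy; rewrite normr0 add0r leNgt; apply/negP => hy'.
  exact: hy.
Qed.

(** An increasing geometric progression is at most its last term times 1 / (1 - 2^(-a)), and the
    last term kept is below Y^a. The bound therefore depends neither on N nor on e. *)
Lemma geometric_trunc_le (R : realType) (e a Y : R) (N : nat) :
  0 < e -> 0 < a -> 0 <= Y ->
  \sum_(0 <= k < N) (if e * 2 ^+ k < Y then (e * 2 ^+ k) `^ a else 0) <=
    (1 - 2 `^ (- a))^-1 * Y `^ a.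
Proof.
move=> e0 a0 Y0; pose z : R := 2 `^ (- a).
have z0 : 0 < z by rewrite powR_gt0.
have z1 : z < 1.
  rewrite /z powRN invf_lt1 ?powR_gt0//.
  rewrite [ltLHS](_ : _ = 1 `^ a); last by rewrite powR1.
  by apply: gt0_ltr_powR; rewrite ?nnegrE//; lra.
have z1' : 0 < 1 - z by rewrite subr_gt0.
pose x k := (e * 2 ^+ k) `^ a.
have e2 k : 0 < e * 2 ^+ k by rewrite mulr_gt0// exprn_gt0.
have xz k : x k = z * x k.+1.
  rewrite /x /z exprS [e * (_ * _)]mulrCA (@powRM _ 2) ?(ltW (e2 _))//.
  rewrite mulrA -powRD; last by rewrite pnatr_eq0 implybT.
  by rewrite addNr powRr0 mul1r.
have sumx N' : \sum_(0 <= k < N'.+1) x k <= (1 - z)^-1 * x N'.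
  elim: N' => [|N' IH].
    rewrite big_nat1 ler_peMl ?powR_ge0// invf_ge1//; lra.
  rewrite big_nat_recr//= (le_trans (lerD IH (lexx _)))// xz.
  by rewrite le_eqVlt; apply/orP; left; apply/eqP; field; rewrite gt_eqF.
elim: N => [|N IHN]; first by rewrite big_geq// mulr_ge0 ?powR_ge0// invr_ge0 ltW.
have [lt|ge] := ltP (e * 2 ^+ N) Y; last first.
  by rewrite big_nat_recr//= ltNge ge addr0.
apply: (@le_trans _ _ (\sum_(0 <= k < N.+1) x k)).
  by apply: ler_sum => k _; case: ifP => // _; exact: powR_ge0.
apply: (le_trans (sumx N)); rewrite ler_wpM2l ?invr_ge0 ?(ltW z1')//.
by apply: powR_le; rewrite ?(ltW a0) ?(ltW (e2 N)) ?(ltW lt).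
Qed.

(** One term suffices for finite y: the last level below y is at least y / 2. *)
Lemma dyadic_layer (R : realType) (e q : R) (y : \bar R) :
  0 < e -> 1 <= q -> (e%:E < y)%E ->
  (y `^ q <= \sum_(k <oo) (if (e * 2 ^+ k)%:E < y then ((2 * (e * 2 ^+ k)) `^ q)%:E else 0))%E.
Proof.
move=> e0 q1 ey; pose u k := if ((e * 2 ^+ k)%:E < y)%E then ((2 * (e * 2 ^+ k)) `^ q)%:E else 0%E.
rewrite -[leRHS]/(\sum_(k <oo) u k)%E.
have u0 k : (0 <= u k)%E.
  by rewrite /u; case: ifP => [_|//]; rewrite lee_fin powR_ge0.
have uk k : ((e * 2 ^+ k)%:E < y)%E ->
    (((2 * (e * 2 ^+ k)) `^ q)%:E <= \sum_(k <oo) u k)%E.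
  move=> ky; rewrite (@nneseriesD1 _ _ k)//= {1}/u ky leeDl//.
  by apply: nneseries_ge0 => j _ _.
case: y ey @u u0 uk => [t| |]// et u u0 uk.
  rewrite lte_fin in et; have [k /andP[k1 k2]] := dyadic_level e0 et.
  apply: le_trans (uk k _); last by rewrite lte_fin.
  rewrite poweR_EFin lee_fin; apply: powR_le; [lra|lra|].
  by rewrite (le_trans k2)// exprS mulrCA.
(* An infinite y exceeds every level, and single terms of the series exceed any bound B. *)
suff -> : (\sum_(k <oo) u k = +oo)%E by rewrite leey.
apply/eqyP => B B0; pose t := Num.max (B + 1) (e + 1).
have et' : e < t by rewrite lt_max ltrDl ltr01 orbT.
have [k /andP[k1 k2]] := dyadic_level e0 et'.
apply: le_trans (uk k (ltry _)); rewrite lee_fin.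
have Bt : B <= 2 * (e * 2 ^+ k).
  rewrite mulrCA -exprS; apply: le_trans k2; rewrite le_max lerDl ler01//.
have t1 : 1 <= 2 * (e * 2 ^+ k).
  rewrite mulrCA -exprS; apply: le_trans k2; rewrite le_max; apply/orP; left; lra.
apply: (le_trans Bt); rewrite -{1}(powRr1 (le_trans ler01 t1)).
exact: ler_powR.
Qed.

(** The factor (2 L)^p comes from the layer of level L, and K (L / 2)^(-r) from the weak type bound
    at half that level. *)
Lemma weak_const (R : realType) (L K p r : R) : 0 < L ->
  (2 * L) `^ p * (K * (L / 2) `^ (- r)) = K * (2 `^ p * 2 `^ r) * L `^ (p - r).
Proof.
move=> L0; have L0' := ltW L0.
have h2 : (2^-1 : R) `^ r = (2 `^ r)^-1.
  by rewrite -[2^-1]powR_inv1// -powRrM mulN1r powRN.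
have Lr : L `^ r != 0 by rewrite gt_eqF// powR_gt0.
have tr : (2 : R) `^ r != 0 by rewrite gt_eqF// powR_gt0.
rewrite powRN (@powRM _ 2 L)// (@powRM _ L 2^-1) ?invr_ge0// h2.
rewrite powRB; last by rewrite (gt_eqF L0) implybT.
by field; rewrite Lr tr.
Qed.

(** Stated for an extended factor because the weight u may take the value +oo. *)
Lemma mule_nneseries_le (R : realType) (y : \bar R) (f : nat -> \bar R) :
  (0 <= y)%E -> (forall k, 0 <= f k)%E ->
  (y * \sum_(k <oo) f k <= \sum_(k <oo) y * f k)%E.
Proof.
case: y => [y| |]// y0 f0; first by rewrite nneseriesZl.
have [[k fk]|h] := pselect (exists k, 0 < f k)%E.
  rewrite (_ : \sum_(k <oo) (+oo * f k) = +oo)%E ?leey//.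
  by apply: (eseries_pinfty _ _ (gt0_mulye fk)) => // j _; rewrite gt_eqF// (lt_le_trans ltNy0)// mule_ge0.
rewrite eseries0 ?mule0; last first.
  move=> k _ _; apply/eqP; rewrite eq_le f0 andbT leNgt; apply/negP => fk.
  by apply: h; exists k.
by apply: nneseries_ge0 => k _ _; rewrite mule_ge0.
Qed.

(** With y = |f(x)| and a = p - r > 0, only the levels below 2 y see the truncated function, and
    their powers a add up to a multiple of y^a. *)
Lemma truncated_moment_sum (R : realType) (e a r p y : R) (N : nat) :
  0 < e -> 0 < a -> 0 < r -> a + r = p -> 0 <= y ->
  \sum_(0 <= k < N) (if (e * 2 ^+ k) / 2 < y then (e * 2 ^+ k) `^ a * y `^ r else 0) <=
    2 `^ a / (1 - 2 `^ (- a)) * y `^ p.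
Proof.
move=> e0 a0 r0 arp y0.
rewrite (eq_bigr (fun k => (if e * 2 ^+ k < 2 * y then (e * 2 ^+ k) `^ a else 0) * y `^ r)).
  rewrite -mulr_suml; apply: (@le_trans _ _ ((1 - 2 `^ (- a))^-1 * (2 * y) `^ a * y `^ r)).
    by rewrite ler_wpM2r ?powR_ge0//; apply: geometric_trunc_le => //; rewrite mulr_ge0.
  rewrite powRM// -arp powRD; last by rewrite gt_eqF// addr_gt0.
  by rewrite le_eqVlt; apply/orP; left; apply/eqP; ring.
move=> k _; rewrite ltr_pdivrMr// [y * 2]mulrC.
by case: ifP => _; rewrite ?mul0r.
Qed.

Lemma strong_type_level (R : realType) (n : nat) (Omega : set 'rV[R]_n.+1)
    (beta p q : R) (u v : 'rV[R]_n.+1 -> \bar R) :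
  open Omega -> ~` Omega !=set0 -> 0 < beta -> beta < 1 -> 1 < p -> p <= q ->
  is_weight Omega u -> is_weight Omega v ->
  A_infty Omega beta (dual_weight p v) -> A_pq Omega beta p q u v ->
  exists2 K : R, 0 <= K & forall (f : 'rV[R]_n.+1 -> R) e,
    measurable_fun (Omega : set (lebesgue_space R n)) (f : lebesgue_space R n -> R) ->
    0 < e ->
    (\int[@lebesgue R n]_(x in level_set Omega beta f e)
       (centered_local_maximal Omega beta f x `^ q * u x) <=
     (K%:E * \int[@lebesgue R n]_(x in Omega) ((`|f x| `^ p)%:E * v x)) `^ (q / p))%E.
Proof.
move=> oO cO0 b0 b1 p1 pq wu wv As Apq.
have [r [K [r1 rp K0 HK]]] := weak_type oO cO0 b0 b1 p1 pq wu wv As Apq.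
have p0 : 0 < p by lra.
have q0 : 0 < q by lra.
have r0 : 0 < r by lra.
have a0 : 0 < p - r by lra.
have qp1 : 1 <= q / p by rewrite ler_pdivlMr// mul1r.
have mO := measurable_open_rV oO.
have [mu_ u0] := weight_on oO wu mO (@subset_refl _ Omega).
have [mv v0] := weight_on oO wv mO (@subset_refl _ Omega).
have [C C0 CE] : exists2 C : R, 0 <= C & C = 2 `^ (p - r) / (1 - 2 `^ (- (p - r))).
  exists (2 `^ (p - r) / (1 - 2 `^ (- (p - r)))) => //.
  rewrite divr_ge0 ?powR_ge0// subr_ge0.
  rewrite powRN invf_le1 ?powR_gt0// [leLHS](_ : _ = 1 `^ (p - r)); last by rewrite powR1.
  by apply: powR_le; lra.
exists (K * (2 `^ p * 2 `^ r) * C); first by rewrite !mulr_ge0 ?powR_ge0.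
move=> f e mf e0.
set M := centered_local_maximal Omega beta f.
pose L k := e * 2 ^+ k.
have L0 k : 0 < L k by rewrite mulr_gt0// exprn_gt0.
pose G k := level_set Omega beta f (L k).
have mG k : measurable (G k : set (lebesgue_space R n)).
  by apply: level_set_measurable => //; exact: ltW.
have G0E : level_set Omega beta f e = G 0%N by rewrite /G /L expr0 mulr1.
have GO k : G k `<=` Omega by move=> x [l []].
have GE k x : Omega x -> (x \in G k) = ((L k)%:E < M x)%E.
  move=> Ox; apply/idP/idP; first by rewrite inE /G -maximal_gtE => -[].
  by move=> h; rewrite inE /G -maximal_gtE; split.
have mM : measurable_fun (Omega : set (lebesgue_space R n)) (M : lebesgue_space R n -> \bar R).
  exact: maximal_measurable.
rewrite G0E.
pose c k := (2 * L k) `^ q.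
have c0 k : 0 <= c k by exact: powR_ge0.
have mpatch k : measurable_fun (G 0%N : set (lebesgue_space R n))
    (u \_ (G k) : lebesgue_space R n -> \bar R).
  apply/(measurable_restrict _ (mG k) (mG 0%N)); apply: measurable_funS mu_; first exact: mO.
  by move=> x [/GO].
have patch0 k x : G 0%N x -> (0 <= (u \_ (G k)) x)%E.
  by move=> /GO Ox; rewrite patchE; case: ifP => // _; exact: u0.
apply: (@le_trans _ _ (\sum_(k <oo) (c k)%:E * weight_mass u (G k))%E).
  apply: (@le_trans _ _ (\int[@lebesgue R n]_(x in G 0%N)
     \sum_(k <oo) (c k)%:E * (u \_ (G k)) x)%E).
    apply: ge0_le_integral; first exact: mG.
    - by move=> x /GO Ox; rewrite mule_ge0 ?poweR_ge0 ?u0.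
    - apply: emeasurable_funM.
        apply: (measurableT_comp (measurable_poweR _)).
        by apply: measurable_funS mM; [exact: mO|exact: GO].
      by apply: measurable_funS mu_; [exact: mO|exact: GO].
    - apply: ge0_emeasurable_sum => [k x Gx _|k _].
        by rewrite mule_ge0 ?lee_fin ?patch0.
      by apply: measurable_funeM; exact: mpatch.
    - move=> x Gx; have Ox := GO _ _ Gx; have ux0 := u0 _ Ox.
      have eM : (e%:E < M x)%E by have := GE 0%N x Ox; rewrite /L expr0 mulr1 mem_set.
      apply: (@le_trans _ _ (u x * \sum_(k <oo)
          (if ((e * 2 ^+ k)%:E < M x)%E then ((2 * (e * 2 ^+ k)) `^ q)%:E else 0%E))%E).
        rewrite muleC lee_wpmul2l//; apply: dyadic_layer => //; lra.
      apply: (le_trans (mule_nneseries_le ux0 _)).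
        by move=> k; case: ifP => [_|//]; rewrite lee_fin powR_ge0.
      apply: lee_nneseries => [k _ _|k _].
        by apply: mule_ge0 => //; case: ifP => [_|//]; rewrite lee_fin powR_ge0.
      by rewrite patchE GE// /c /L; case: ifP => _; rewrite ?mule0// muleC.
  rewrite integral_nneseries; last 3 first.
  - exact: mG.
  - by move=> k; apply: measurable_funeM; exact: mpatch.
  - by move=> k x Gx; rewrite mule_ge0 ?lee_fin ?patch0.
  apply: lee_nneseries => [k _ _|k _].
    by apply: integral_ge0 => x Gx; rewrite mule_ge0 ?lee_fin ?patch0.
  rewrite ge0_integralZl; [|exact: mG|exact: mpatch|exact: patch0|by rewrite lee_fin].
  rewrite lee_wpmul2l ?lee_fin// -integral_mkcondr.
  by apply: (weight_massS oO wu) => //; exact: measurableI.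
pose h k := truncate_above Omega f (L k / 2).
have mh k := @truncate_above_measurable R n Omega f (L k / 2) oO mf.
have mhr k : measurable_fun (Omega : set (lebesgue_space R n))
    ((fun x => (`|h k x| `^ r)%:E) : lebesgue_space R n -> \bar R).
  apply/measurable_EFinP; apply: (measurableT_comp (measurable_powR r)).
  exact: measurableT_comp (mh k).
pose F k := (\int[@lebesgue R n]_(x in Omega) ((`|h k x| `^ r)%:E * v x))%E.
have F0 k : (0 <= F k)%E.
  by apply: integral_ge0 => x Ox; rewrite mule_ge0 ?lee_fin ?powR_ge0 ?v0.
pose d k := K * (2 `^ p * 2 `^ r) * L k `^ (p - r).
have d0 k : 0 <= d k by rewrite !mulr_ge0 ?powR_ge0.
have qp0 : 0 <= q / p by lra.
have term k : ((c k)%:E * weight_mass u (G k) <= ((d k)%:E * F k) `^ (q / p))%E.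
  have [mlev Hlev] := HK (h k) (L k / 2) (mh k) (divr_gt0 (L0 k) (ltr0Sn R 1)).
  apply: (@le_trans _ _ ((c k)%:E * ((K * (L k / 2) `^ (- r))%:E * F k) `^ (q / p))%E).
    apply: lee_wpmul2l; first by rewrite lee_fin.
    have lo : level_set Omega beta (h k) (L k / 2) `<=` Omega by move=> x [l []].
    have sub := level_set_truncate oO b0 b1 mf (L0 k).
    exact: (le_trans (weight_massS oO wu (mG k) mlev sub lo) Hlev).
  (* The layer factor has exponent q; written as a power q / p, it enters the bracket of the weak
     type bound. *)
  have -> : c k = ((2 * L k) `^ p) `^ (q / p).
    by rewrite -powRrM /c; congr (_ `^ _); field; rewrite gt_eqF.
  have K1 : 0 <= (2 * L k) `^ p by exact: powR_ge0.
  have K2 : 0 <= K * (L k / 2) `^ (- r) by rewrite mulr_ge0 ?powR_ge0.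
  rewrite -poweR_EFin -poweRM; [|by rewrite lee_fin|exact: mule_ge0].
  by rewrite muleA -EFinM weak_const.
have hE k x : Omega x ->
    `|h k x| `^ r = if L k / 2 < `|f x| then `|f x| `^ r else 0.
  move=> Ox; rewrite /h /truncate_above patchE; case: ifPn => [|].
    by rewrite inE => -[_ /= ->].
  rewrite notin_setE /= => hx; case: ifP => [hf|_]; first by exfalso; apply: hx.
  by rewrite normr0 powR0// gt_eqF.
have mfp : measurable_fun (Omega : set (lebesgue_space R n))
    ((fun x => (`|f x| `^ p)%:E) : lebesgue_space R n -> \bar R).
  apply/measurable_EFinP; apply: (measurableT_comp (measurable_powR p)).
  exact: measurableT_comp.
apply: nneseries_le => [k|N].
  by rewrite mule_ge0 ?lee_fin//; apply: integral_ge0 => x /GO; exact: u0.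
apply: (@le_trans _ _ (\sum_(0 <= k < N) ((d k)%:E * F k) `^ (q / p))%E).
  by apply: lee_sum => k _; exact: term.
(* Once the sum is inside the power, all levels come under one integral and can be summed
   pointwise. *)
apply: (le_trans (sum_poweR_le _ qp1 _)).
  by move=> k; rewrite mule_ge0 ?lee_fin.
apply: poweR_le => //.
  by apply: sume_ge0 => k _; rewrite mule_ge0 ?lee_fin.
rewrite -ge0_integralZl; [|exact: mO| | |]; last 3 first.
- by apply: emeasurable_funM; [exact: mfp|exact: mv].
- by move=> x Ox; rewrite mule_ge0 ?lee_fin ?powR_ge0 ?v0.
- by rewrite lee_fin !mulr_ge0 ?powR_ge0.
rewrite [leLHS](_ : _ = \int[@lebesgue R n]_(x in Omega)
    \sum_(0 <= k < N) (d k)%:E * ((`|h k x| `^ r)%:E * v x))%E; last first.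
  rewrite ge0_integral_sum; [|exact: mO| |]; last 2 first.
  - by move=> k; apply: measurable_funeM; apply: emeasurable_funM; [exact: mhr|exact: mv].
  - by move=> k x Ox; rewrite !mule_ge0 ?lee_fin ?powR_ge0 ?v0.
  apply: eq_bigr => k _; rewrite ge0_integralZl; [by []|exact: mO| | |].
  - by apply: emeasurable_funM; [exact: mhr|exact: mv].
  - by move=> x Ox; rewrite mule_ge0 ?lee_fin ?powR_ge0 ?v0.
  - by rewrite lee_fin.
apply: ge0_le_integral; first exact: mO.
- by move=> x Ox; apply: sume_ge0 => k _; rewrite !mule_ge0 ?lee_fin ?powR_ge0 ?v0.
- apply: emeasurable_sum => k; apply: measurable_funeM; apply: emeasurable_funM.
    exact: mhr.
  exact: mv.
- by apply: measurable_funeM; apply: emeasurable_funM; [exact: mfp|exact: mv].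
- move=> x Ox.
  under eq_bigr do rewrite muleA -EFinM.
  rewrite -ge0_sume_distrl; last by move=> k _; rewrite lee_fin mulr_ge0 ?powR_ge0.
  rewrite muleA -EFinM lee_wpmul2r ?v0// sumEFin lee_fin.
  rewrite (eq_bigr (fun k => K * (2 `^ p * 2 `^ r) *
    (if e * 2 ^+ k / 2 < `|f x| then (e * 2 ^+ k) `^ (p - r) * `|f x| `^ r else 0))); last first.
    by move=> k _; rewrite hE// /d /L; case: ifP => _; [ring|rewrite !mulr0].
  rewrite -mulr_sumr -[leRHS]mulrA; apply: ler_wpM2l; first by rewrite !mulr_ge0 ?powR_ge0.
  by rewrite CE; apply: truncated_moment_sum => //; rewrite subrK.
Qed.

Lemma strong_type (R : realType) (n : nat) (Omega : set 'rV[R]_n.+1)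
    (beta p q : R) (u v : 'rV[R]_n.+1 -> \bar R) :
  open Omega -> ~` Omega !=set0 -> 0 < beta -> beta < 1 -> 1 < p -> p <= q ->
  is_weight Omega u -> is_weight Omega v ->
  A_infty Omega beta (dual_weight p v) -> A_pq Omega beta p q u v ->
  bounded_Lp_Lq Omega p q v u (centered_local_maximal Omega beta).
Proof.
move=> oO cO0 b0 b1 p1 pq wu wv As Apq.
have [K K0 HK] := strong_type_level oO cO0 b0 b1 p1 pq wu wv As Apq.
have p0 : 0 < p by lra.
have q0 : 0 < q by lra.
have mO := measurable_open_rV oO.
have [mu_ u0] := weight_on oO wu mO (@subset_refl _ Omega).
have [mv v0] := weight_on oO wv mO (@subset_refl _ Omega).
exists (K `^ p^-1) => f [mf _].
set F := (\int[@lebesgue R n]_(x in Omega) ((`|f x| `^ p)%:E * v x))%E.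
have F0 : (0 <= F)%E.
  by apply: integral_ge0 => x Ox; rewrite mule_ge0 ?lee_fin ?powR_ge0 ?v0.
set M := centered_local_maximal Omega beta f.
have M0 x : Omega x -> (0 <= M x)%E by move=> Ox; exact: maximal_ge0.
have mM : measurable_fun (Omega : set (lebesgue_space R n)) (M : lebesgue_space R n -> \bar R).
  exact: maximal_measurable.
pose g x := (M x `^ q * u x)%E.
have g0 x : Omega x -> (0 <= g x)%E by move=> Ox; rewrite mule_ge0 ?poweR_ge0 ?u0.
have mg : measurable_fun (Omega : set (lebesgue_space R n)) (g : lebesgue_space R n -> \bar R).
  apply: emeasurable_funM; last exact: mu_.
  exact: (measurableT_comp (measurable_poweR _)).
(* The levels 1 / (j + 1) exhaust {M f > 0}, off which the integrand vanishes. *)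
pose G j := level_set Omega beta f (j.+1%:R^-1).
have mG j : measurable (G j : set (lebesgue_space R n)).
  by apply: level_set_measurable => //; rewrite invr_ge0.
have GO j : G j `<=` Omega by move=> x [l []].
have ndG : nondecreasing_seq G.
  move=> i j ij; apply/subsetPset; rewrite /G -!maximal_gtE => x [Ox /= h]; split => //=.
  by apply: le_lt_trans h; rewrite lee_fin lef_pV2 ?posrE ?ltr0n// ler_nat.
have GE : \bigcup_j G j = Omega `&` [set x | (0 < M x)%E].
  apply/seteqP; split => x.
    move=> [j _]; rewrite /G -maximal_gtE => -[Ox /= h]; split => //=.
    by apply: lt_trans h; rewrite lte_fin invr_gt0.
  move=> [Ox /= Mx]; have [j hj] : exists j : nat, ((j.+1%:R^-1)%:E < M x)%E.
    move: Mx; case: (M x) => [t| |]// t0; last by exists 0%N; rewrite ltry.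
    rewrite lte_fin in t0; have [j] := ltr_add_invr t0; rewrite add0r => hj.
    by exists j; rewrite lte_fin.
  by exists j => //; rewrite /G -maximal_gtE.
have intE : (\int[@lebesgue R n]_(x in Omega) (`|M x| `^ q * u x) =
    \int[@lebesgue R n]_(x in \bigcup_j G j) g x)%E.
  rewrite GE integral_mkcondr; apply: eq_integral => x; rewrite inE => Ox.
  rewrite gee0_abs ?M0// patchE; case: ifPn => //; rewrite notin_setE /= => /negP.
  rewrite -leNgt => Mle; have -> : M x = 0%E by apply/eqP; rewrite eq_le Mle M0.
  by rewrite poweR0r ?mul0e// gt_eqF.
have cvG := @ge0_nondecreasing_set_cvg_integral _ (lebesgue_space R n) R G g (@lebesgue R n)
  ndG mG (fun j => measurable_funS mO (@GO j) mg) (fun j x Gx => g0 x (GO j x Gx)).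
have main : (\int[@lebesgue R n]_(x in Omega) (`|M x| `^ q * u x) <= (K%:E * F) `^ (q / p))%E.
  rewrite intE; apply: (cvge_to_le cvG); apply: nearW => j.
  by apply: HK => //; rewrite invr_gt0.
apply: (@le_trans _ _ (((K%:E * F) `^ (q / p)) `^ q^-1)%E).
  apply: poweR_le => //; first by rewrite invr_ge0 ltW.
  by apply: integral_ge0 => x Ox; rewrite mule_ge0 ?poweR_ge0 ?u0.
rewrite -poweRrM (_ : q / p / q = p^-1); last by field; rewrite !gt_eqF.
by rewrite poweRM ?lee_fin.
Qed.

(** * Necessity *)

Lemma bernoulli_sub (R : realType) (e : R) (N : nat) : 0 <= e <= 1 ->
  1 - N%:R * e <= (1 - e) ^+ N.
Proof.
move=> /andP[e0 e1]; elim: N => [|N IHN]; first by rewrite expr0 mul0r subr0.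
rewrite exprS; apply: (@le_trans _ _ ((1 - e) * (1 - N%:R * e))).
  rewrite -natr1; have : 0 <= N%:R * e * e by rewrite !mulr_ge0.
  by nra.
by rewrite ler_wpM2l// subr_ge0.
Qed.

(** By Bernoulli's inequality the shell between the two cubes has relative volume at most (n + 1) e;
    for small e, A_infty gives it at most half of the mass. *)
Lemma mass_shrink (R : realType) (n : nat) (Omega : set 'rV[R]_n.+1) (beta : R)
    (w : 'rV[R]_n.+1 -> \bar R) :
  open Omega -> 0 < beta -> beta < 1 -> A_infty Omega beta w ->
  exists e : R, [/\ 0 < e, e < 1 & forall x l, Omega x -> local_radii Omega beta x l ->
    (weight_mass w (cube x l) <= 2%:E * weight_mass w (cube x ((1 - e) * l)))%E].
Proof.
move=> oO b0 b1 Aw; have [c [delta [c0 d0 H]]] := A_infty_real oO b0 b1 Aw.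
have ww : is_weight Omega w by case: Aw.
have N0 : 0 < n.+1%:R :> R by rewrite ltr0n.
(* The solution of c ((n + 1) e0)^delta = 1/2. The cap 1/2 below keeps e < 1. *)
pose e0 := (2 * c)^-1 `^ delta^-1 / n.+1%:R.
have e00 : 0 < e0 by rewrite divr_gt0// powR_gt0// invr_gt0 mulr_gt0.
pose e := Num.min e0 2^-1.
have ep : 0 < e by rewrite lt_min e00 invr_gt0 ltr0n.
have e2 : e <= 2^-1 by rewrite ge_min lexx orbT.
have ee0 : e <= e0 by rewrite ge_min lexx.
have e1 : e < 1 by lra.
exists e; split => // x l Ox lx.
have QO := local_cube_sub b0 b1 lx.
have l0 : 0 < l by case: lx.
have l'0 : 0 < (1 - e) * l by rewrite mulr_gt0// subr_gt0.
have sub : cube x ((1 - e) * l) `<=` cube x l.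
  by apply: cube_sub; rewrite subrr normr0 add0r ler_piMl ?(ltW l0)// lerBlDr lerDl ltW.
set Q := cube x l in QO sub *; set Q' := cube x _ in sub *.
have mQ : measurable (Q : set (lebesgue_space R n)) by exact: measurable_cube.
have mQ' : measurable (Q' : set (lebesgue_space R n)) by exact: measurable_cube.
have [mw w0] := weight_on oO ww mQ QO.
have [W W0 QW] := weight_mass_fin ww QO.
have [W' W'0 QW'] := weight_mass_fin ww (subset_trans sub QO).
have mD : measurable (Q `\` Q' : set (lebesgue_space R n)) by exact: measurableD.
have split_mass : (weight_mass w Q = weight_mass w Q' + weight_mass w (Q `\` Q'))%E.
  rewrite /weight_mass -{1}(setDUK sub) ge0_integral_setU//.
  - by rewrite setDUK.
  - by rewrite setDUK.
  - by rewrite disj_set2E setDIK.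
have vol : (lebesgue (Q `\` Q') <= (n.+1%:R * e * (2 * l) ^+ n.+1)%:E)%E.
  have mQf : (lebesgue Q < +oo)%E by rewrite (lebesgue_cube x (ltW l0)) ltry.
  have -> := @measureD _ (lebesgue_space R n) R (@lebesgue R n) Q Q' mQ mQ' mQf.
  rewrite setIidr//; apply: (@le_trans _ _ (lebesgue Q - lebesgue Q')%E); first exact: lexx.
  rewrite (lebesgue_cube x (ltW l0)) (lebesgue_cube x (ltW l'0)).
  rewrite -EFinB lee_fin mulrCA [((1 - e) * _) ^+ _]exprMn -{1}[(2 * l) ^+ _]mul1r -mulrBl.
  rewrite ler_wpM2r ?exprn_ge0 ?mulr_ge0 ?(ltW l0)//.
  by have := @bernoulli_sub R e n.+1; rewrite (ltW ep) (ltW e1) => /(_ isT); lra.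
have := H x l W Ox lx QW (Q `\` Q') (n.+1%:R * e) mD (@subIsetl _ _ _).
move=> /(_ (mulr_ge0 (ltW N0) (ltW ep)) vol) => HE.
have cE : c * (n.+1%:R * e) `^ delta <= 2^-1.
  apply: (@le_trans _ _ (c * (2 * c)^-1)); last first.
    by rewrite invfM mulrCA mulfV ?mulr1// gt_eqF.
  rewrite ler_wpM2l ?(ltW c0)//.
  rewrite -[leRHS]powRr1; last by rewrite invr_ge0 mulr_ge0// ltW.
  rewrite -[X in _ <= _ `^ X](mulVf (lt0r_neq0 d0)) powRrM; apply: powR_le; first exact: ltW.
    by rewrite mulr_ge0 ?(ltW N0) ?(ltW ep).
  by rewrite mulrC -ler_pdivlMr.
have HE' : (weight_mass w (Q `\` Q') <= (W / 2)%:E)%E.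
  by apply: (le_trans HE); rewrite lee_fin mulrC ler_wpM2l.
move: split_mass; rewrite QW QW' => split_mass.
have : (W%:E <= W'%:E + (W / 2)%:E)%E by rewrite split_mass leeD2l.
by rewrite -EFinD -EFinM !lee_fin; lra.
Qed.

Lemma expr_small (R : realType) (z k : R) : 0 < z -> z < 1 -> 0 < k ->
  exists K, z ^+ K <= k.
Proof.
move=> z0 z1 k0; have nz : `|z| < 1 by rewrite gtr0_norm.
have := @cvgr_lt _ _ _ _ _ _ (@cvg_geometric R 1 z nz) k k0.
move=> /(_ _)[N _ /(_ N)]; rewrite /geometric /= mul1r leqnn => H.
by exists N; exact/ltW/H.
Qed.

(** The cube is shrunk K times about x and then moved along the segment to y in steps so short that
    each cube, shrunk once more, lies in the next one. Every shrinking costs a factor 2. As k <= 1 -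
    beta, all cubes of half side k l centered in Q(x, l) belong to F_beta. *)
Lemma mass_doubling (R : realType) (n : nat) (Omega : set 'rV[R]_n.+1) (beta k0 : R)
    (w : 'rV[R]_n.+1 -> \bar R) :
  open Omega -> ~` Omega !=set0 -> 0 < beta -> beta < 1 -> A_infty Omega beta w ->
  0 < k0 -> k0 <= 1 - beta ->
  exists k D : R, [/\ 0 < k, k <= k0, 0 <= D &
    forall x l y, Omega x -> local_radii Omega beta x l -> cube x l y ->
    (weight_mass w (cube x l) <= D%:E * weight_mass w (cube y (k * l)))%E].
Proof.
move=> oO cO0 b0 b1 Aw k00 k01.
have [e [e0 e1 He]] := mass_shrink oO b0 b1 Aw.
have ww : is_weight Omega w by case: Aw.
have e1' : 0 < 1 - e by rewrite subr_gt0.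
have [|K hK] := @expr_small R (1 - e) k0 e1' _ k00; first by rewrite ltrBlDr ltrDl.
have [k [kp kk0 kE]] : exists k, [/\ 0 < k, k <= k0 & (1 - e) ^+ K = k].
  by exists ((1 - e) ^+ K); split => //; rewrite exprn_gt0.
(* This many steps make each of them at most e k l long, the margin left by one shrinking. *)
have [M hM] : exists M : nat, (e * k)^-1 <= M.+1%:R.
  by exists (Num.truncn (e * k)^-1); rewrite ltW// truncnS_gt.
have M0 : 0 < M.+1%:R :> R by rewrite ltr0n.
exists k, (2 ^+ K * 2 ^+ M.+1).
split; [exact: kp|exact: kk0|by rewrite mulr_ge0 ?exprn_ge0|].
move=> x l y Ox lx xy.
have [l0 ld] := lx.
have shrink j : local_radii Omega beta x ((1 - e) ^+ j * l) /\
    (weight_mass w (cube x l) <= (2 ^+ j)%:E * weight_mass w (cube x ((1 - e) ^+ j * l)))%E.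
  elim: j => [|j [lj IHj]]; first by rewrite !expr0 mul1r mul1e.
  split.
    split; first by rewrite mulr_gt0// exprn_gt0.
    apply: le_lt_trans lj.2; rewrite exprS -mulrA ler_piMl ?(ltW lj.1)//.
    by rewrite lerBlDr lerDl ltW.
  apply: (le_trans IHj); rewrite exprSr EFinM -muleA lee_wpmul2l ?lee_fin ?exprn_ge0//.
  by rewrite [in leRHS]exprS -mulrA; exact: He.
pose z j := x + (j%:R / M.+1%:R) *: (y - x).
have zx j : (j <= M.+1)%N -> cube x l (z j).
  move=> jM; rewrite /cube /closed_ball_ /= /z opprD addrA subrr add0r normrN normrZ.
  rewrite ger0_norm ?divr_ge0// -[leRHS]mul1r.
  apply: ler_pM; rewrite ?divr_ge0 ?normr_ge0//.
    by rewrite ler_pdivrMr// mul1r ler_nat.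
  by rewrite distrC.
have kl0 : 0 < k * l by rewrite mulr_gt0.
have zl j : (j <= M.+1)%N -> local_radii Omega beta (z j) (k * l).
  move=> jM; split => //; have := dist_to_lip x (z j) cO0.
  have := zx j jM; rewrite /cube /closed_ball_ /= => h1 h2.
  have h3 : beta * dist_to x (~` Omega) <= beta * dist_to (z j) (~` Omega) + beta * l.
    rewrite -mulrDr ler_pM2l// (le_trans h2)// lerD2l//.
  have h4 : k * l <= (1 - beta) * l.
    by apply: ler_wpM2r; [exact: ltW|exact: le_trans kk0 k01].
  by lra.
have zO j : (j <= M.+1)%N -> Omega (z j).
  by move=> jM; apply: (local_cube_sub b0 b1 lx); exact: zx.
have zz j : `|z j.+1 - z j| <= e * (k * l).
  rewrite /z opprD addrACA subrr add0r -scalerBl normrZ -mulrBl -natr1 addrAC subrr add0r mul1r.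
  rewrite gtr0_norm ?invr_gt0// mulrC ler_pdivrMr//.
  have xyl : `|y - x| <= l by rewrite distrC.
  apply: (le_trans xyl); rewrite mulrA mulrAC ler_peMl ?(ltW l0)//.
  have ek0 : 0 < e * k by rewrite mulr_gt0.
  by rewrite -ler_pdivrMl// mulr1.
have move_ j : (j <= M.+1)%N ->
    (weight_mass w (cube x (k * l)) <= (2 ^+ j)%:E * weight_mass w (cube (z j) (k * l)))%E.
  elim: j => [_|j IHj jM]; first by rewrite expr0 mul1e /z mul0r scale0r addr0.
  have jM' := ltnW jM; apply: (le_trans (IHj jM')).
  rewrite exprSr EFinM -muleA lee_wpmul2l ?lee_fin ?exprn_ge0//.
  apply: (le_trans (He _ _ (zO _ jM') (zl _ jM'))).
  rewrite lee_wpmul2l ?lee_fin//; apply: (weight_massS oO ww).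
  - exact: measurable_cube.
  - exact: measurable_cube.
  - by apply: cube_sub; have := zz j; lra.
  - exact: (local_cube_sub b0 b1 (zl _ jM)).
have [_ /le_trans] := shrink K; rewrite kE; apply; rewrite EFinM -muleA lee_wpmul2l ?lee_fin ?exprn_ge0//.
have zM : z M.+1 = y.
  by rewrite /z divff ?pnatr_eq0// scale1r addrC subrK.
by have := move_ M.+1 (leqnn _); rewrite zM.
Qed.

(** The arithmetic of the necessity: U, W are the masses of Q for u and sigma, and a, S those of a
    small cube. The testing inequality is raised to the power p, one factor S > 0 is cancelled, and
    the comparisons with U and W are inserted. *)
Lemma pq_combine (R : realType) (p q : R) (n : nat) (k l C D m U W S a : R) :
  1 < p -> p <= q -> 0 < k -> 0 < l -> 0 <= C -> 0 <= D -> 0 <= m ->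
  0 <= U -> 0 <= W -> 0 < S -> 0 <= a ->
  U <= m * a -> W <= D * S ->
  a `^ q^-1 * S <= C * (2 * (2 * (k * l))) ^+ n.+1 * S `^ p^-1 ->
  U `^ (p / q) / (2 * l) ^+ n.+1 * (W / (2 * l) ^+ n.+1) `^ (p - 1) <=
    m `^ (p / q) * D `^ (p - 1) * (C * (2 * k) ^+ n.+1) `^ p.
Proof.
move=> p1 pq k0 l0 C0 D0 m0 U0 W0 S0 a0 Ua WS test.
have p0 : 0 < p by lra.
have q0 : 0 < q by lra.
have p10 : 0 <= p - 1 by lra.
have pq0 : 0 <= p / q by rewrite divr_ge0// ltW.
set V := (2 * l) ^+ n.+1.
have V0 : 0 < V by rewrite exprn_gt0// mulr_gt0.
have [E E0 EE] : exists2 E, 0 <= E & C * (2 * k) ^+ n.+1 = E.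
  by exists (C * (2 * k) ^+ n.+1) => //; rewrite mulr_ge0// exprn_ge0// mulr_ge0// ltW.
have {}test : a `^ q^-1 * S <= E * V * S `^ p^-1.
  apply: (le_trans test); rewrite -EE /V -[X in _ <= X * _]mulrA -exprMn.
  by rewrite (_ : 2 * k * (2 * l) = 2 * (2 * (k * l)))//; ring.
have test_p : a `^ (p / q) * S `^ (p - 1) <= E `^ p * V `^ p.
  have h : (a `^ q^-1 * S) `^ p <= (E * V * S `^ p^-1) `^ p.
    by apply: powR_le => //; [exact: ltW|rewrite mulr_ge0 ?powR_ge0 ?ltW].
  have h1 : (a `^ q^-1 * S) `^ p = a `^ (p / q) * S `^ p.
    by rewrite powRM ?powR_ge0 ?(ltW S0)// -powRrM [q^-1 * p]mulrC.
  have h2 : (E * V * S `^ p^-1) `^ p = E `^ p * V `^ p * S.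
    rewrite (powRM p (mulr_ge0 E0 (ltW V0)) (powR_ge0 _ _)).
    by rewrite (@powRM _ E) ?(ltW V0)// -powRrM mulVf ?gt_eqF// (powRr1 (ltW S0)).
  have SE : S `^ p = S * S `^ (p - 1).
    rewrite -{2}(powRr1 (ltW S0)) -powRD ?(gt_eqF S0) ?implybT//.
    by congr (_ `^ _); ring.
  by rewrite h1 h2 SE mulrCA [leRHS]mulrC ler_pM2l in h.
have UU : U `^ (p / q) <= m `^ (p / q) * a `^ (p / q).
  by rewrite -powRM//; apply: powR_le.
have WW : W `^ (p - 1) <= D `^ (p - 1) * S `^ (p - 1).
  by rewrite -powRM ?(ltW S0)//; apply: powR_le.
have Vp : V `^ p = V * V `^ (p - 1).
  rewrite -{2}(powRr1 (ltW V0)) -powRD ?(gt_eqF V0) ?implybT//.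
  by congr (_ `^ _); ring.
have Vp0 : 0 < V `^ p by rewrite powR_gt0.
have WV : (W / V) `^ (p - 1) = W `^ (p - 1) / V `^ (p - 1).
  by rewrite powRM ?invr_ge0 ?(ltW V0)// -[V^-1]powR_inv1 ?(ltW V0)// -powRrM mulN1r powRN.
rewrite WV (_ : _ * _ = U `^ (p / q) * W `^ (p - 1) / V `^ p); last first.
  by rewrite Vp; field; rewrite (gt_eqF V0) gt_eqF// powR_gt0.
rewrite ler_pdivrMr// EE.
apply: (le_trans (ler_pM (powR_ge0 _ _) (powR_ge0 _ _) UU WW)).
rewrite mulrACA -[leRHS]mulrA ler_wpM2l// mulr_ge0 ?powR_ge0//.
Qed.

(* Tested on the dual weight restricted to Q', the operator is at least
   sigma(Q') / |Q(z, 2r)| at every z in Q'. *)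
Lemma maximal_testing (R : realType) (n : nat) (Omega : set 'rV[R]_n.+1)
    (beta p q : R) (u v : 'rV[R]_n.+1 -> \bar R) :
  open Omega -> ~` Omega !=set0 -> 0 < beta -> beta < 1 -> 1 < p -> p <= q ->
  is_weight Omega u -> is_weight Omega v -> is_weight Omega (dual_weight p v) ->
  bounded_Lp_Lq Omega p q v u (centered_local_maximal Omega beta) ->
  exists2 C : R, 0 <= C & forall y r U S, 0 < r -> cube y r `<=` Omega ->
    (forall z, cube y r z -> local_radii Omega beta z (2 * r)) ->
    weight_mass u (cube y r) = U%:E -> weight_mass (dual_weight p v) (cube y r) = S%:E ->
    U `^ q^-1 * S <= C * (2 * (2 * r)) ^+ n.+1 * S `^ p^-1.
Proof.
move=> oO cO0 b0 b1 p1 pq wu wv ws [C0 HC].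
have p0 : 0 < p by lra.
have q0 : 0 < q by lra.
have mO := measurable_open_rV oO.
have [mu_ u0] := weight_on oO wu mO (@subset_refl _ Omega).
have [mv v0] := weight_on oO wv mO (@subset_refl _ Omega).
have [ms s0] := weight_on oO ws mO (@subset_refl _ Omega).
exists (Num.max 0 C0); first by rewrite le_max lexx.
set C := Num.max 0 C0; have C_ge0 : 0 <= C by rewrite le_max lexx.
move=> y r U S r0 QO Qz QU QS.
set s := dual_weight p v in ms s0 QS *.
set Q := cube y r in QO Qz QU QS *.
have mQ : measurable (Q : set (lebesgue_space R n)) by exact: measurable_cube.
have [muQ u0Q] := weight_on oO wu mQ QO.
have [msQ s0Q] := weight_on oO ws mQ QO.
(* Test functions are real valued; [fine] alters sigma only where it is +oo, a null subset of Q. *)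
pose f : 'rV[R]_n.+1 -> R := (fun x => fine (s x)) \_ Q.
have U0 : 0 <= U by have [U' U'0] := weight_mass_fin wu QO; rewrite QU => -[->].
have S0 : 0 <= S by have [S' S'0] := weight_mass_fin ws QO; rewrite QS => -[->].
have mf : measurable_fun (Omega : set (lebesgue_space R n)) (f : lebesgue_space R n -> R).
  apply/(measurable_restrict _ mQ mO); rewrite setIidr; last exact: QO.
  exact: (measurableT_comp (fine_measurable measurableT) msQ).
(* Equality on Q where 0 < v < +oo, since there sigma^p v = sigma. If v x = 0, then sigma x = +oo
   stands on the right; if v x = +oo, then sigma x = 0 and the left side vanishes. *)
have fv x : Omega x -> ((`|f x| `^ p)%:E * v x <= (s \_ Q) x)%E.
  move=> Ox; rewrite /f !patchE; case: ifPn => xQ; last first.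
    by rewrite normr0 powR0 ?mul0e// gt_eqF.
  have := v0 x Ox; have [sfin|] := boolP (s x \is a fin_num); last first.
    move=> sfin _; rewrite (_ : s x = +oo%E) ?leey//.
    by apply/eqP; move: sfin; rewrite ge0_fin_numE ?s0// -leNgt leye_eq.
  have [vfin|] := boolP (v x \is a fin_num); last first.
    move=> vfin vx0; have vy : v x = +oo%E.
      by apply/eqP; move: vfin; rewrite ge0_fin_numE// -leNgt leye_eq.
    rewrite /s /dual_weight vy poweRyr ?invr_eq0 ?subr_eq0 ?gt_eqF//.
    by rewrite invey /= normr0 powR0 ?gt_eqF// mul0e.
  move=> vx0; have [t [t0 -> sE]] := dual_weight_gt0 p1 vx0 vfin sfin.
  rewrite -/s in sE; rewrite sE /= ger0_norm ?powR_ge0// -EFinM lee_fin.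
  rewrite -powRrM -{2}(powRr1 (ltW t0)) -powRD; last by rewrite (gt_eqF t0) implybT.
  rewrite (_ : _ + 1 = - (p - 1)^-1)//; field.
  by rewrite subr_eq0 gt_eqF.
have intfv : (\int[@lebesgue R n]_(x in Omega) ((`|f x| `^ p)%:E * v x) <= S%:E)%E.
  rewrite -QS /weight_mass -(setIidr QO) integral_mkcondr; apply: ge0_le_integral.
  - exact: mO.
  - by move=> x Ox; rewrite mule_ge0 ?lee_fin ?powR_ge0 ?v0.
  - apply: emeasurable_funM; last exact: mv.
    apply/measurable_EFinP; apply: (measurableT_comp (measurable_powR p)).
    exact: (measurableT_comp (@normr_measurable R setT) mf).
  - by apply/(measurable_restrict _ mQ mO); rewrite setIidr.
  - exact: fv.
have fLp : in_Lp Omega p v f by split => //; exact: le_lt_trans intfv (ltry _).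
have r20 : 0 < 2 * r by rewrite mulr_gt0.
have V0 := cube_vol_gt0 n r20; set V := (2 * (2 * r)) ^+ n.+1 in V0 *.
have Mlow z : Q z -> ((S / V)%:E <= centered_local_maximal Omega beta f z)%E.
  move=> Qz_z; apply: (@le_trans _ _ ((lebesgue (cube z (2 * r)))^-1 *
      \int[@lebesgue R n]_(x in cube z (2 * r)) `|f x|%:E)%E); last first.
    by apply: ereal_sup_ubound; exists (2 * r) => //; exact: Qz.
  rewrite (lebesgue_cube z (ltW r20)) inver (gt_eqF V0) mulrC EFinM.
  rewrite lee_wpmul2l ?lee_fin ?invr_ge0 ?(ltW V0)//.
  have subQ : Q `<=` cube z (2 * r).
    by apply: cube_sub; move: Qz_z; rewrite /Q /cube /closed_ball_ /= distrC; lra.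
  have zO : cube z (2 * r) `<=` Omega by apply: (local_cube_sub b0 b1); exact: Qz.
  have mzf : measurable_fun (cube z (2 * r) : set (lebesgue_space R n))
      ((fun x => `|f x|%:E) : lebesgue_space R n -> \bar R).
    apply/measurable_EFinP; apply: (measurable_funS mO zO).
    exact: (measurableT_comp (@normr_measurable R setT) mf).
  apply: (@le_trans _ _ (\int[@lebesgue R n]_(x in Q) `|f x|%:E)%E); last first.
    apply: ge0_subset_integral; [exact: mQ|exact: measurable_cube|exact: mzf| |exact: subQ].
    by move=> x _; rewrite lee_fin.
  have sfin : (\int[@lebesgue R n]_(x in Q) s x < +oo)%E.
    by rewrite -/(weight_mass s Q) QS ltry.
  rewrite -QS /weight_mass; apply: (ae_ge0_le_integral mQ s0Q msQ).
  - by move=> x _; rewrite lee_fin.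
  - by apply: measurable_funS mzf; [exact: measurable_cube|exact: subQ].
  - apply: filterS (ge0_integral_fin_ae mQ msQ s0Q sfin) => x h Qx.
    rewrite /f patchE mem_set// ger0_norm ?fine_ge0 ?s0Q// fineK//.
    exact: h.
have SV0 : 0 <= S / V by rewrite divr_ge0// ltW.
have := HC f fLp; set I := (\int[@lebesgue R n]_(x in Omega) (_ * u x))%E.
set J := (\int[@lebesgue R n]_(x in Omega) (_ * v x))%E.
have J0 : (0 <= J)%E.
  by apply: integral_ge0 => x Ox; rewrite mule_ge0 ?lee_fin ?powR_ge0 ?v0.
have M0 x : Omega x -> (0 <= centered_local_maximal Omega beta f x)%E.
  by move=> Ox; exact: maximal_ge0.
have Ilow : (((S / V) `^ q * U)%:E <= I)%E.
  rewrite EFinM -QU /weight_mass -ge0_integralZl;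
    [|exact: mQ|exact: muQ|exact: u0Q|by rewrite lee_fin powR_ge0].
  have mMu : measurable_fun (Omega : set (lebesgue_space R n))
      ((fun x => `|centered_local_maximal Omega beta f x| `^ q * u x)%E
        : lebesgue_space R n -> \bar R).
    apply: emeasurable_funM; last exact: mu_.
    apply: (measurableT_comp (measurable_poweR _)).
    exact: (measurableT_comp (@abse_measurable R setT) (maximal_measurable oO cO0 b0 b1 mf)).
  apply: (@le_trans _ _ (\int[@lebesgue R n]_(x in Q)
    (`|centered_local_maximal Omega beta f x| `^ q * u x))%E).
    apply: ge0_le_integral; first exact: mQ.
    - by move=> x Qx; rewrite mule_ge0 ?lee_fin ?powR_ge0 ?u0Q.
    - by apply: measurable_funeM; exact: muQ.
    - by apply: measurable_funS mMu; [exact: mO|exact: QO].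
    - move=> x Qx; rewrite lee_wpmul2r ?u0Q// gee0_abs ?M0//; last exact: QO.
      by rewrite -poweR_EFin; apply: poweR_le; rewrite ?lee_fin ?(ltW q0)//; exact: Mlow.
  apply: ge0_subset_integral; [exact: mQ|exact: mO|exact: mMu| |exact: QO].
  by move=> x Ox; rewrite mule_ge0 ?poweR_ge0 ?u0.
have Iq : ((U `^ q^-1 * (S / V))%:E <= I `^ q^-1)%E.
  apply: (@le_trans _ _ (((S / V) `^ q * U)%:E `^ q^-1)%E).
    rewrite poweR_EFin powRM ?powR_ge0// -powRrM mulfV ?gt_eqF// powRr1//.
    by rewrite mulrC.
  by apply: poweR_le => //; [rewrite invr_ge0 ltW|rewrite lee_fin mulr_ge0 ?powR_ge0].
have Jp : (J `^ p^-1 <= (S `^ p^-1)%:E)%E.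
  by rewrite -poweR_EFin; apply: poweR_le => //; rewrite invr_ge0 ltW.
move=> /(le_trans Iq) H.
have : ((U `^ q^-1 * (S / V))%:E <= (C * S `^ p^-1)%:E)%E.
  apply: (le_trans H); apply: (@le_trans _ _ (C%:E * J `^ p^-1)%E).
    by rewrite lee_wpmul2r ?poweR_ge0// lee_fin le_max lexx orbT.
  by rewrite EFinM lee_wpmul2l.
by rewrite lee_fin mulrA ler_pdivrMr// mulrAC.
Qed.

Lemma pigeonhole_sum (R : realType) (T : finType) (k0 : T) (a : T -> R) (U : R) :
  U <= \sum_k a k -> exists k, U <= #|T|%:R * a k.
Proof.
move=> Ua; pose k := [arg max_(k > k0) a k]%O; exists k; apply: (le_trans Ua).
rewrite mulr_natl -sumr_const; apply: ler_sum => i _.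
by rewrite /k; case: arg_maxP => // j _ /(_ i isT).
Qed.

(** Every small cube of the cover carries a fixed share of sigma(Q), by [mass_doubling], and at
    least one carries a fixed share of u(Q); testing on that one is enough. *)
Lemma bounded_A_pq (R : realType) (n : nat) (Omega : set 'rV[R]_n.+1)
    (beta p q : R) (u v : 'rV[R]_n.+1 -> \bar R) :
  open Omega -> ~` Omega !=set0 -> 0 < beta -> beta < 1 -> 1 < p -> p <= q ->
  is_weight Omega u -> is_weight Omega v -> A_infty Omega beta (dual_weight p v) ->
  bounded_Lp_Lq Omega p q v u (centered_local_maximal Omega beta) ->
  A_pq Omega beta p q u v.
Proof.
move=> oO cO0 b0 b1 p1 pq wu wv As Hb.
have p0 : 0 < p by lra.
have q0 : 0 < q by lra.
have p10 : 0 < p - 1 by lra.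
have ws : is_weight Omega (dual_weight p v) by case: As.
have [C C0 HC] := maximal_testing oO cO0 b0 b1 p1 pq wu wv ws Hb.
have b1' : 0 < 1 - beta by rewrite subr_gt0.
(* A point of a small cube is within l + k l of x; 4 k l <= (1 - beta) l leaves room for a cube of
   half side 2 k l around it. *)
have k00 : 0 < (1 - beta) / 4 by rewrite divr_gt0.
have k01 : (1 - beta) / 4 <= 1 - beta by lra.
have [k [D [kp kk0 D0 HD]]] := mass_doubling oO cO0 b0 b1 As k00 k01.
have [N hN] : exists N : nat, k^-1 <= N.+1%:R.
  by exists (Num.truncn k^-1); rewrite ltW// truncnS_gt.
pose T := {ffun 'I_n.+1 -> 'I_N.+1}.
pose m : R := #|T|%:R.
pose B := m `^ (p / q) * D `^ (p - 1) * (C * (2 * k) ^+ n.+1) `^ p.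
apply/(A_pqP q oO b0 b1 wu ws); exists B.
  by rewrite !mulr_ge0 ?powR_ge0.
move=> x l U W Ox lx QU QW.
have [l0 ld] := lx.
have QO := local_cube_sub b0 b1 lx.
have U0 : 0 <= U by have [U' U'0] := weight_mass_fin wu QO; rewrite QU => -[->].
have W0 : 0 <= W by have [S' S'0] := weight_mass_fin ws QO; rewrite QW => -[->].
have V0 := cube_vol_gt0 n l0; set V := (2 * l) ^+ n.+1 in V0 *.
have kl0 : 0 < k * l by rewrite mulr_gt0.
have kl4 : 4 * (k * l) <= (1 - beta) * l.
  by rewrite mulrA ler_wpM2r ?(ltW l0)//; lra.
(* If sigma(Q) = 0, the quantity to be bounded is 0, as p > 1. Otherwise sigma of the small cube is
   positive and may be cancelled. *)
have [Wz|Wnz] := eqVneq W 0.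
  by rewrite Wz mul0r powR0 ?mulr0 ?mulr_ge0 ?powR_ge0// gt_eqF.
have {Wnz} W_gt0 : 0 < W by rewrite lt_neqAle eq_sym Wnz.
have [y [yx ycov]] := @grid R n N x l (ltW l0).
have small z k' : cube (y k') (k * l) z -> local_radii Omega beta z (2 * (k * l)).
  move=> yz; split; first by rewrite mulr_gt0.
  have h1 := dist_to_lip x z cO0; have h2 := yx k'.
  rewrite /cube /closed_ball_ /= in yz h2.
  have h3 : `|x - z| <= l + k * l.
    have -> : x - z = (x - y k') + (y k' - z) by rewrite addrA subrK.
    by rewrite (le_trans (ler_normD _ _))// lerD.
  have h4 : beta * dist_to x (~` Omega) <= beta * dist_to z (~` Omega) + beta * (l + k * l).
    by rewrite -mulrDr ler_pM2l// (le_trans h1)// lerD2l.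
  have h5 : beta * (k * l) <= k * l by rewrite ler_piMl ?(ltW kl0)// ltW.
  by lra.
have smallO k' : cube (y k') (k * l) `<=` Omega.
  move=> z /small zl; apply: (local_cube_sub b0 b1 zl).
  by apply: cube_center; rewrite ltW// mulr_gt0.
have /choice[a ha] : forall k', exists a : R, 0 <= a /\ weight_mass u (cube (y k') (k * l)) = a%:E.
  by move=> k'; have [a a0 aE] := weight_mass_fin wu (smallO k'); exists a.
have mO := measurable_open_rV oO.
have [mu_ u0] := weight_on oO wu mO (@subset_refl _ Omega).
have Usum : U <= \sum_k' a k'.
  have cov z : cube x l z -> exists2 w, w \in [seq y k' | k' <- enum T] & cube w (k * l) z.
    move=> /ycov[k' _ zk']; exists (y k'); first by apply: map_f; rewrite mem_enum.
    move: zk'; rewrite /cube /closed_ball_ /= => /le_trans; apply.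
    by rewrite [leRHS]mulrC ler_pM2l// -[leRHS]invrK lef_pV2 ?posrE ?invr_gt0 ?ltr0n.
  have := @integral_cover_le R n Omega (cube x l) u [seq y k' | k' <- enum T] (fun=> k * l)
    mO mu_ u0 (@measurable_cube R n x l) QO cov.
  rewrite -/(weight_mass u (cube x l)) QU big_map big_enum /=.
  rewrite (eq_bigr (fun k' => (a k')%:E)); last first.
    by move=> k' _; rewrite setIidr//; exact: (ha k').2.
  by rewrite sumEFin lee_fin.
have [k' Uk] := pigeonhole_sum [ffun=> ord0] Usum.
rewrite -/T -/m in Uk.
have [a0 aE] := ha k'.
have [S S0 SE] := weight_mass_fin ws (smallO k').
have WS : W <= D * S.
  by have := HD x l (y k') Ox lx (yx k'); rewrite QW SE -EFinM lee_fin.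
have S_gt0 : 0 < S.
  rewrite lt_neqAle S0 andbT eq_sym; apply/eqP => Sz.
  by move: WS; rewrite Sz mulr0 leNgt W_gt0.
have test := HC (y k') (k * l) (a k') S kl0 (smallO k') (fun z => @small z k') aE SE.
have m0 : 0 <= m by rewrite ler0n.
exact: (@pq_combine R p q n k l C D m U W S (a k')).
Qed.

Theorem theorem1p19 (R : realType) (n : nat) (Omega : set 'rV[R]_n.+1)
    (p q beta : R) (u v : 'rV[R]_n.+1 -> \bar R)
    (Omega_open : open Omega) (Omega_nonempty : Omega !=set0)
    (Omega_proper : Omega <> [set: 'rV[R]_n.+1])
    (p_gt1 : 1 < p) (p_le_q : p <= q)
    (beta_gt0 : 0 < beta) (beta_lt1 : beta < 1)
    (u_weight : is_weight Omega u) (v_weight : is_weight Omega v)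
    (sigma_A_infty : A_infty Omega beta (dual_weight p v)) :
  bounded_Lp_Lq Omega p q v u (centered_local_maximal Omega beta) <->
  A_pq Omega beta p q u v.
Proof.
have cO0 : ~` Omega !=set0.
  by apply/set0P; apply: contra_notN Omega_proper => /eqP; rewrite -setCT => /setC_inj.
split; first exact: bounded_A_pq.
exact: strong_type.
Qed.
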